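(* For any integer $n\ge2$, $\kappa_n>n^{-n/2}$.
   Context: $\mathcal{L}_n=\mathrm{SL}_n(\mathbb{R})/\mathrm{SL}_n(\mathbb{Z})$ is the space of unimodular (covolume one) lattices in $\mathbb{R}^n$. A symmetric box in $\mathbb{R}^n$ is a set of the form $[-a_1,a_1]\times\cdots\times[-a_n,a_n]$; it is admissible for $x\in\mathcal{L}_n$ if its interior contains no nonzero point of $x$. The Mordell constant of $x$ is $\kappa(x)=\frac{1}{2^n}\sup_{\mathcal{B}}\mathrm{Vol}(\mathcal{B})$, the supremum being over symmetric boxes $\mathcal{B}$ admissible for $x$, and $\kappa_n=\inf\{\kappa(x):x\in\mathcal{L}_n\}$. *)

(* Defs.v *)
From HB Require Import structures.
From mathcomp Require Import all_boot all_order all_algebra.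
From mathcomp Require Import all_classical all_reals all_analysis.
Import Order.TTheory GRing.Theory Num.Theory.
Import numFieldNormedType.Exports.

Set Implicit Arguments.
Unset Strict Implicit.
Unset Printing Implicit Defensive.

Local Open Scope classical_set_scope.
Local Open Scope ring_scope.

(* g Z^n; this set determines, and is determined by, the coset g SL_n(Z)
   when g is in SL_n(R). *)
Definition lattice_of (R : realType) (n : nat) (g : 'M[R]_n) : set 'cV[R]_n :=
  [set g *m map_mx intr z | z in [set: 'cV[int]_n]].

(* SL_n(R) / SL_n(Z). *)
Definition unimodular_lattices (R : realType) (n : nat) : set (set 'cV[R]_n) :=
  [set lattice_of g | g in [set g : 'M[R]_n | \det g = 1]].
Arguments unimodular_lattices : clear implicits.

Definition symmetric_box (R : realType) (n : nat) (a : 'I_n -> R) :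
    set 'cV[R]_n :=
  [set v | forall i, - a i <= v i ord0 <= a i].

(* The n-dimensional volume of [symmetric_box a]; meaningful for a >= 0. *)
Definition box_volume (R : realType) (n : nat) (a : 'I_n -> R) : R :=
  \prod_(i < n) (2 * a i).

Definition admissible (R : realType) (n : nat) (x B : set 'cV[R]_n) : Prop :=
  forall v, x v -> B° v -> v = 0.

(* The supremum and infimum are taken in the extended reals, so no
   boundedness result (Minkowski's theorem) is built into the definitions. *)
Definition mordell_constant (R : realType) (n : nat) (x : set 'cV[R]_n) :
    \bar R :=
  (((2 ^+ n)^-1)%:E *
   ereal_sup [set (box_volume a)%:E | a in
     [set a : 'I_n -> R |
       (forall i, (0 <= a i)%R) /\ admissible x (symmetric_box a)]])%E.

Definition kappa_inf (R : realType) (n : nat) : \bar R :=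
  ereal_inf [set mordell_constant x | x in unimodular_lattices R n].
Arguments kappa_inf : clear implicits.

(* Main.v *)
Require Import Defs.
From mathcomp Require Import all_boot all_order all_algebra.
From mathcomp Require Import all_classical all_reals all_analysis.
From mathcomp Require Import perm ring lra zify.
Import Order.TTheory GRing.Theory Num.Theory.
Import numFieldNormedType.Exports.
Set Implicit Arguments.
Unset Strict Implicit.
Unset Printing Implicit Defensive.
Local Open Scope ring_scope.

(** Given a unimodular lattice, suppose that the open box with half-sides [a i]
  contains no nonzero lattice vector while its closure contains [n] linearly
  independent ones.  These have determinant at least 1 in absolute value, and by
  Hadamard's inequality at most [n^(n/2) * \prod_i a i]; so
  [\prod_i a i >= n^(-n/2)].

  Such a box (up to a factor close to 1) is found with Scarf's lemma, applied to
  finitely many lattice vectors [v] ordered in [n] ways by [`|v i|]: it produces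
  [n] vectors which are simultaneously dominating, i.e. the box they span
  contains no further vector in its interior, and feasible, i.e. a generic
  positive vector [b] lies in the cone of their representatives [+-v], hence
  they are independent.  The slack vectors [e_i] of Scarf's lemma are harmless
  because there are only polylogarithmically many relevant vectors up to height
  [T]: by a union bound some positive linear form [l] satisfies
  [`|l v| >= `|v| / polylog T] on all of them.  Choosing the signs with
  [l (+-v) > 0] bounds the coefficients of [b], so a box containing a slack has
  one side [T] and the others at least [1 / polylog T], and by the pigeonhole
  principle it cannot avoid the lattice.

  For the strict, uniform inequality: unless Hadamard's inequality or the index
  of the sublattice leaves room, the normalised [n] vectors form a basis and a
  matrix with entries close to [+-1]; then lattice points have coordinates
  close to integers of equal parity, and the box can be made half as long again
  in one direction. *)

(** * Scarf's lemma *)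

Lemma xor_card (T : finType) (P F : pred T) :
  \big[addb/false]_(i | P i) F i = odd #|[set i | P i && F i]|.
Proof.
rewrite -sum1dep_card big_mkcondr /= (big_morph odd oddD (erefl _)).
by apply: eq_bigr => i _; case: (F i).
Qed.

(** * Dominating sets and the parity of their walls *)

Section Walls.
Variables (n : nat) (E : finType) (c : 'I_n -> E -> nat) (s : 'I_n -> E).
Hypothesis n_gt1 : (1 < n)%N.
Hypothesis c_inj : forall i, injective (c i).
Hypothesis s_inj : injective s.
Hypothesis s_top : forall i e, (c i e <= c i (s i))%N.
Hypothesis s_low : forall i k e, e \notin codom s -> i != k ->
  (c k (s i) < c k e)%N.

(** With [c i] ranking vectors by their [i]-th coordinate in absolute value, this says that no
    element lies strictly inside the box spanned by [J]. *)
Definition dominating (J : {set E}) :=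
  [forall e, exists i, forall j in J, (c i j <= c i e)%N].

Let slacks := [set s i | i : 'I_n].

Section Wall.
Variable W : {set E}.
Hypothesis cardW : #|W|.+1 = n.

Let w0P : exists w, w \in W.
Proof. by apply/set0Pn; rewrite -card_gt0; move: n_gt1; rewrite -cardW. Qed.

Let w0 := xchoose w0P.

Let mu i := [arg max_(w > w0 in W) c i w].

Let muW i : mu i \in W.
Proof. by rewrite /mu; case: arg_maxnP => //; apply: (xchooseP w0P). Qed.

Let mu_max i w : w \in W -> (c i w <= c i (mu i))%N.
Proof.
rewrite /mu; case: arg_maxnP; first exact: (xchooseP w0P).
by move=> j _ maxj /maxj.
Qed.

Let mu_uniq i w : w \in W -> (forall v, v \in W -> (c i v <= c i w)%N) ->
  mu i = w.
Proof.
by move=> wW wmax; apply: (@c_inj i); apply/eqP; rewrite eqn_leq mu_max // wmax.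
Qed.

(** An element completes the wall [W] in direction [q] if it exceeds [W] in ranking [q] only and is
    lowest there among all elements staying below [W] in the other rankings. *)
Let below q := [pred f | [forall (i | i != q), (c i f < c i (mu i))%N]].

Let completes q e :=
  [&& below q e, (c q (mu q) < c q e)%N &
      [forall (f | below q f), (c q e <= c q f)%N]].

Let completesP q e : reflect
  [/\ forall i, i != q -> (c i e < c i (mu i))%N, (c q (mu q) < c q e)%N &
      forall f, (forall i, i != q -> (c i f < c i (mu i))%N) ->
        (c q e <= c q f)%N]
  (completes q e).
Proof.
apply: (iffP and3P) => [[/'forall_implyP h1 h2 /'forall_implyP h3]|[h1 h2 h3]].
  by split=> // f hf; apply: h3; apply/'forall_implyP.
split=> //; first exact/'forall_implyP.
by apply/'forall_implyP => f /'forall_implyP; apply: h3.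
Qed.

Let completes_notin q e : completes q e -> e \notin W.
Proof.
case/completesP=> _ h _; apply/negP => /(mu_max q).
by rewrite leqNgt h.
Qed.

Let completes_dominating q e : completes q e -> dominating (e |: W).
Proof.
case/completesP => h1 h2 h3; apply/forallP => f.
have [/existsP[i /andP[iq hi]]|] :=
  boolP [exists i, (i != q) && (c i (mu i) <= c i f)%N].
  apply/existsP; exists i; apply/'forall_implyP => j.
  rewrite in_setU1 => /orP[/eqP->|/(mu_max i) hj].
    exact: leq_trans (ltnW (h1 _ iq)) hi.
  exact: leq_trans hi.
rewrite negb_exists => /forallP hf; apply/existsP; exists q.
have {}hf : (c q e <= c q f)%N.
  by apply: h3 => i iq; move: (hf i); rewrite iq /= -ltnNge.
apply/'forall_implyP => j.
rewrite in_setU1 => /orP[/eqP->//|/(mu_max q) hj].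
exact: leq_trans (leq_trans hj (ltnW h2)) hf.
Qed.

(** By domination each of the [n] elements of [e |: W] is on top in some ranking, hence in exactly
    one. The direction [q] is the ranking topped by [e]; the others are topped by distinct elements
    of [W]. *)
Let dominating_completes e : e \notin W -> dominating (e |: W) ->
  exists2 q, completes q e & {in [pred i | i != q] &, injective mu}.
Proof.
move=> eW /forallP domJ; set J := e |: W.
have eJ : e \in J by rewrite setU11.
pose A i := [arg max_(j > e in J) c i j].
have AJ i : A i \in J by rewrite /A; case: arg_maxnP.
have Amax i j : j \in J -> (c i j <= c i (A i))%N.
  by rewrite /A; case: arg_maxnP => // k _ maxk /maxk.
have imA : [set A i | i : 'I_n] = J.
  apply/setP => j; apply/imsetP/idP => [[i _ ->//]|jJ].
  have /existsP[i /'forall_implyP hi] := domJ j.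
  exists i => //; apply: (@c_inj i); apply/eqP.
  by rewrite eqn_leq Amax //= hi.
have A_inj : injective A.
  have : #|[set A i | i : 'I_n]| == #|'I_n|.
    by rewrite imA cardsU1 eW add1n cardW card_ord.
  by move/imset_injP => Ainj i j; apply: Ainj.
have /imsetP[q _ eq] : e \in [set A i | i : 'I_n] by rewrite imA.
have A_mu i : i != q -> A i = mu i.
  move=> iq; have := AJ i; rewrite in_setU1 => /orP[|AW].
    by rewrite eq (inj_eq A_inj) (negPf iq).
  by apply/esym/mu_uniq => // v vW; apply: Amax; rewrite in_setU1 vW orbT.
have e_lt i : i != q -> (c i e < c i (mu i))%N.
  move=> iq; rewrite ltn_neqAle -A_mu // Amax // andbT (inj_eq (@c_inj i)) eq.
  by rewrite (inj_eq A_inj) eq_sym.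
exists q; last first.
  by move=> i j; rewrite !inE => iq jq; rewrite -!A_mu //; apply: A_inj.
have mu_lt : (c q (mu q) < c q e)%N.
  rewrite ltn_neqAle (inj_eq (@c_inj q)) {2}eq Amax ?in_setU1 ?muW ?orbT //.
  by rewrite andbT; apply: contraNneq eW => <-.
apply/completesP; split => // f hf.
have /existsP[i /'forall_implyP hi] := domJ f.
have [<-|iq] := eqVneq i q; first exact: hi.
by have := hi (mu i); rewrite in_setU1 muW orbT leqNgt hf // => /(_ isT).
Qed.

Let completes_inj q e : completes q e -> {in [pred i | i != q] &, injective mu}.
Proof.
move=> he; have [q' /completesP[_ h2 _] hinj] :=
  dominating_completes (completes_notin he) (completes_dominating he).
suff -> : q = q' by [].
apply/eqP/negPn/negP => qq'; have /completesP[h1 _ _] := he.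
by have := ltn_trans h2 (h1 q' _); rewrite ltnn eq_sym => /(_ qq').
Qed.

Let completes_uniq q e f : completes q e -> completes q f -> e = f.
Proof.
move=> /completesP[e1 _ e3] /completesP[f1 _ f3].
by apply: (@c_inj q); apply/eqP; rewrite eqn_leq e3 // f3.
Qed.

Let completion_ex q f : below q f ->
  (forall e, below q e -> (c q (mu q) < c q e)%N) -> exists e, completes q e.
Proof.
move=> bf hq; pose e := [arg min_(e < f | below q e) c q e]; exists e.
rewrite /e; case: arg_minnP => // k bk mink; apply/and3P; split=> //.
  exact: hq.
exact/'forall_implyP.
Qed.

Let wallset := [set e | (e \notin W) && dominating (e |: W)].

Let wallP e : reflect (exists q, completes q e) (e \in wallset).
Proof.
rewrite inE; apply: (iffP andP) => [[eW /dominating_completes[] // q hq _]|].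
  by exists q.
by case=> q hq; split; [exact: completes_notin hq|exact: completes_dominating hq].
Qed.

(** The [n] tops [mu i] lie among [n - 1] elements and are distinct away from a completed direction,
    so there is a single coincidence [mu p = mu q0], and only [q0] and [p] can be completed, each
    uniquely. If one is, so is the other: [s p] is a candidate since [u] lies above it in all
    rankings but [p]. Thus there are 0 or 2 completions. *)
Let wall_inner u : u \in W -> u \notin codom s -> ~~ odd #|wallset|.
Proof.
move=> uW us; have [->|[e0]] := set_0Vmem wallset; first by rewrite cards0.
move=> /wallP[q0 he0].
have inj0 := completes_inj he0.
have [p pq0 mup] : exists2 p, p != q0 & mu p = mu q0.
  have : [set mu i | i in [pred i | i != q0]] == W.
    rewrite eqEcard; apply/andP; split.
      by apply/fintype.subsetP => _ /imsetP[i _ ->].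
    rewrite card_in_imset // -ltnS cardW.
    have -> : #|[pred i | i != q0]| = n.-1 by rewrite (cardC1 q0) card_ord.
    exact: leqSpred.
  move/eqP/setP/(_ (mu q0)); rewrite muW => /imsetP[p pq ->].
  by exists p.
have two q e : completes q e -> (q == q0) || (q == p).
  move=> /completes_inj hinj; apply/norP => -[qq0 qp].
  have := hinj p q0; rewrite !inE eq_sym qp eq_sym qq0 => /(_ isT isT mup) pE.
  by rewrite pE eqxx in pq0.
have /completesP[e01 e02 e03] := he0.
have [ep hep] : exists e, completes p e.
  apply: (@completion_ex _ (s p)) => [|e /'forall_implyP be].
    apply/'forall_implyP => i ip; apply: leq_trans (mu_max i uW).
    by apply: s_low => //; rewrite eq_sym.
  (* A candidate under the wall in ranking [p] as well would compete with [e0] in ranking [q0] and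
     lie below its minimum; equality is excluded by [mu p = mu q0]. *)
  rewrite ltnNge; apply/negP; rewrite leq_eqVlt => /orP[/eqP/c_inj emu|elt].
    by have := be q0; rewrite eq_sym pq0 emu mup ltnn => /(_ isT).
  have : (c q0 e0 <= c q0 e)%N.
    by apply: e03 => i iq0; have [->//|/be] := eqVneq i p.
  rewrite leqNgt (ltn_trans _ e02) //; apply: be; by rewrite eq_sym.
have -> : wallset = [set e0; ep].
  apply/setP => e; rewrite !inE; apply/idP/idP.
    move=> he; have /wallP[q hq] : e \in wallset by rewrite inE.
    case/orP: (two _ _ hq) => /eqP qE; rewrite qE in hq.
      by rewrite (completes_uniq hq he0) eqxx.
    by rewrite (completes_uniq hq hep) eqxx orbT.
  have wall q f : completes q f -> (f \notin W) && dominating (f |: W).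
    by move=> hf; have /wallP : exists q, completes q f by [exists q]; rewrite inE.
  by case/orP => /eqP->; [exact: wall he0|exact: wall hep].
rewrite cards2; suff -> : e0 != ep by [].
apply/eqP => e0p; have /completesP[_ h _] := hep.
by have := e01 p pq0; rewrite e0p ltnNge ltnW.
Qed.

(** Only direction [k] can be completed: in any other, the new element would lie under some slack
    [s j], [j != k], in ranking [k], where that slack is below every non-slack. *)
Let wall_boundary k : W = slacks :\ s k -> odd #|wallset|.
Proof.
move=> WE.
have sW j : j != k -> s j \in W.
  by move=> jk; rewrite WE !inE (inj_eq s_inj) jk imset_f.
have mus i : i != k -> mu i = s i by move=> ik; apply: mu_uniq => //; apply: sW.
have [j jk mukE] : exists2 j, j != k & mu k = s j.
  have := muW k; rewrite WE !inE => /andP[+ /imsetP[j _ muE]].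
  by rewrite muE (inj_eq s_inj) => jk; exists j.
have kP e : e \notin W -> e != s k -> e \notin codom s.
  move=> eW esk; apply/codomP => -[l el]; move: eW esk; rewrite el.
  by have [->|/sW->//] := eqVneq l k; rewrite eqxx.
have [e he] : exists e, completes k e.
  apply: (@completion_ex _ (s k)) => [|e /'forall_implyP be].
    apply/'forall_implyP => i ik; rewrite mus // ltn_neqAle s_top andbT.
    by rewrite (inj_eq (@c_inj i)) (inj_eq s_inj) eq_sym.
  have eW : e \notin W.
    rewrite WE !inE; apply/andP => -[ek /imsetP[l _ el]].
    rewrite el (inj_eq s_inj) in ek.
    by have := be l ek; rewrite el mus // ltnn.
  have [->|ek] := eqVneq e (s k).
    by rewrite mukE ltn_neqAle s_top andbT (inj_eq (@c_inj k)) (inj_eq s_inj).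
  by rewrite mukE; apply: s_low => //; apply: kP.
suff -> : wallset = [set e] by rewrite cards1.
apply/setP => f; rewrite [RHS]inE; apply/wallP/eqP => [[q hq]|->]; last by exists k.
have [qk|qk] := eqVneq q k; first by rewrite qk in hq; apply: completes_uniq he.
have /completesP[h1 _ _] := hq.
have := h1 k; rewrite eq_sym qk mukE => /(_ isT) flt.
have fk : f != s k by apply: contraTneq flt => ->; rewrite -leqNgt s_top.
have := s_low (kP _ (completes_notin hq) fk) jk.
by rewrite ltnNge ltnW.
Qed.

(** Modulo 2, the chain of all dominating [n]-sets has the same boundary as the simplex formed by
    the slacks. *)
Lemma wall_parity :
  \big[addb/false]_(e | e \notin W) dominating (e |: W) =
  [exists k, W == slacks :\ s k].
Proof.
rewrite (xor_card (fun e => e \notin W) (fun e => dominating (e |: W))).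
have [/existsP[k /eqP WE]|hW] := boolP [exists k, W == slacks :\ s k].
  exact: wall_boundary WE.
have [Ws|/subsetPn[u uW us]] := boolP (W \subset slacks); last first.
  apply/negbTE/(wall_inner uW); apply: contra us => /codomP[k ->].
  exact: imset_f.
case/negP: hW.
have : #|slacks :\: W| == 1%N.
  rewrite cardsD (finset.setIidPr Ws) card_imset // card_ord -cardW subSn // subnn.
  by [].
case/cards1P => e eE.
have : e \in slacks by have := set11 e; rewrite -eE inE => /andP[].
case/imsetP=> k _ ek; apply/existsP; exists k; rewrite -ek -eE.
by rewrite finset.setDDr finset.setDv finset.set0U (finset.setIidPr Ws).
Qed.

End Wall.
End Walls.

Lemma linear_dependency (F : fieldType) (n : nat) (E : finType)
    (B : E -> 'cV[F]_n) (K : {set E}) : (n < #|K|)%N ->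
  exists y : E -> F, [/\ exists e, y e != 0, forall e, e \notin K -> y e = 0 &
    \sum_e y e *: B e = 0].
Proof.
move=> nK; pose M := \matrix_(i < #|K|) (B (enum_val i))^T.
have : kermx M != 0.
  rewrite kermx_eq0 -row_leq_rank -ltnNge.
  exact: leq_ltn_trans (rank_leq_col M) nK.
case/rowV0Pn => u /sub_kermxP uM0 /rV0Pn[i0 ui0].
have [e0 e0K] : exists e, e \in K.
  by apply/set0Pn; rewrite -card_gt0; apply: leq_trans nK.
pose y e := if e \in K then u 0 (enum_rank_in e0K e) else 0.
exists y; split.
- by exists (enum_val i0); rewrite /y enum_valP enum_valK_in.
- by move=> e eK; rewrite /y (negPf eK).
- have : (u *m M)^T = 0 by rewrite uM0 trmx0.
  rewrite mulmx_sum_row linear_sum => {2}<-.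
  rewrite (bigID (mem K)) /= [X in _ + X]big1 ?addr0; last first.
    by move=> e eK; rewrite /y (negPf eK) scale0r.
  rewrite (reindex (enum_val : 'I_#|K| -> E)) /=; last first.
    exact: (enum_val_bij_in e0K).
  apply: eq_big => [i|i _]; first by rewrite enum_valP.
  by rewrite linearZ /= rowK trmxK /y enum_valP enum_valK_in.
Qed.

(** * Feasible sets and the pivot step *)

Section Pivot.
Variables (R : realFieldType) (n : nat) (E : finType).
Variables (B : E -> 'cV[R]_n) (b : 'cV[R]_n).
Hypothesis pointed : forall y : E -> R, (forall e, 0 <= y e) ->
  \sum_e y e *: B e = 0 -> forall e, y e = 0.
Hypothesis b_gen : forall x : E -> R, \sum_e x e *: B e = b ->
  (n <= #|[set e | (x e != 0)%R]|)%N.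

Definition feasible (J : {set E}) := exists x : E -> R,
  [/\ forall e, 0 <= x e, forall e, e \notin J -> x e = 0 &
      \sum_e x e *: B e = b].

Lemma feasible_support (J : {set E}) (x : E -> R) : #|J| = n ->
  (forall e, e \notin J -> x e = 0) -> \sum_e x e *: B e = b ->
  forall e, e \in J -> x e != 0.
Proof.
move=> cJ x0 xb e eJ.
suff : [set e | x e != 0] == J by move/eqP/setP/(_ e); rewrite inE eJ.
rewrite eqEcard cJ (b_gen xb) andbT; apply/fintype.subsetP => f.
by rewrite inE; apply: contra_neqT => /x0.
Qed.

(** Shifting [x] along a relation [y] until one coefficient vanishes would express [b] by fewer than
    [n] vectors. *)
Lemma feasible_free (J : {set E}) (x y : E -> R) : #|J| = n ->
  (forall e, e \notin J -> x e = 0) -> \sum_e x e *: B e = b ->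
  (forall e, e \notin J -> y e = 0) -> \sum_e y e *: B e = 0 ->
  forall e, y e = 0.
Proof.
move=> cJ x0 xb y0 yb e; apply/eqP/negPn/negP => ye.
have eJ : e \in J by apply: contraNT ye => /y0->.
pose t := x e / y e.
have /feasible_support : forall f, f \notin J -> x f - t * y f = 0.
  by move=> f fJ; rewrite x0 // y0 // mulr0 subr0.
move=> /(_ cJ) h; suff /h/(_ e eJ) : \sum_f (x f - t * y f) *: B f = b.
  by rewrite /t divfK // subrr eqxx.
under eq_bigr do rewrite scalerBl -scalerA.
by rewrite sumrB -scaler_sumr yb xb scaler0 subr0.
Qed.

(** This is a simplex pivot. The solutions supported on the [n + 1] vectors of [K] form a line; by
    [pointed] its nonnegative part is a segment, one end of which omits [k0]. By [b_gen] the other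
    end omits exactly one element, [k1]. *)
Lemma pivot (K : {set E}) (k0 : E) : #|K| = n.+1 -> k0 \in K ->
  feasible (K :\ k0) -> exists k1, [/\ k1 \in K, k1 != k0 &
    forall k, k \in K -> k != k0 -> feasible (K :\ k) <-> k = k1].
Proof.
move=> cK k0K [x [x_ge0 x0 xb]].
have cKk k : k \in K -> #|K :\ k| = n.
  by move=> kK; apply/eqP; rewrite -(eqn_add2l 1) -{1}[1%N]/(true : nat) -kK -cardsD1 cK.
have cJ := cKk _ k0K.
have x_gt0 e : e \in K :\ k0 -> 0 < x e.
  by move=> eJ; rewrite lt_def x_ge0 (feasible_support cJ x0 xb).
have xk0 : x k0 = 0 by apply: x0; rewrite !inE eqxx.
have [y [yk0 y0 yb]] : exists y : E -> R, [/\ y k0 = 1,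
    forall e, e \notin K -> y e = 0 & \sum_e y e *: B e = 0].
  have [y [[e ye] y0 yb]] := linear_dependency B (eq_leq (esym cK)).
  have yk0 : y k0 != 0.
    apply: contraNneq ye => yk0; apply/eqP/(feasible_free cJ x0 xb _ yb) => f.
    by rewrite !inE negb_and negbK => /orP[/eqP->//|/y0].
  exists (fun e => (y k0)^-1 * y e); split; first by rewrite mulVf.
    by move=> f fK; rewrite (y0 f fK) mulr0.
  by under eq_bigr do rewrite -scalerA; rewrite -scaler_sumr yb scaler0.
have [k2 yk2] : exists k, y k < 0.
  have [/existsP//|/existsPn h] := boolP [exists k, y k < 0].
  have /(_ k0)/eqP : forall e, y e = 0 by apply: pointed => // e; rewrite leNgt.
  by rewrite yk0 oner_eq0.
have neg_in k : y k < 0 -> k \in K :\ k0.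
  move=> yk; rewrite !inE; apply/andP; split.
    by apply: contraTneq yk => ->; rewrite yk0 ltr10.
  by apply: contraTT yk => /y0 ->; rewrite ltxx.
(* Ratio test: [k1] is the first coefficient to vanish when [x] moves along [y]. *)
pose k1 := [arg min_(k < k2 | y k < 0) (x k / - y k)]%O.
have [yk1 k1min] : y k1 < 0 /\ forall k, y k < 0 -> x k1 / - y k1 <= x k / - y k.
  by rewrite /k1; case: arg_minP.
have /setD1P[k1k0 k1K] := neg_in _ yk1.
pose t := x k1 / - y k1.
have t_ge0 : 0 <= t by rewrite divr_ge0 // oppr_ge0 ltW.
pose x' e := x e + t * y e.
have x'_ge0 e : 0 <= x' e.
  rewrite /x'; have [ye|ye] := leP 0 (y e).
    by rewrite addr_ge0 // mulr_ge0.
  have := k1min e ye; rewrite -/t ler_pdivlMr ?oppr_gt0 // mulrN.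
  by rewrite -subr_ge0 opprK.
have x'b : \sum_e x' e *: B e = b.
  under eq_bigr do rewrite scalerDl -scalerA.
  by rewrite big_split /= -scaler_sumr yb xb scaler0 addr0.
have x'k1 : x' k1 = 0.
  by rewrite /x' /t invrN mulrN mulNr divfK ?subrr // lt_eqF.
have x'0 e : e \notin K :\ k1 -> x' e = 0.
  rewrite !inE negb_and negbK => /orP[/eqP->//|eK].
  by rewrite /x' y0 // x0 ?inE ?(negPf eK) ?andbF // mulr0 addr0.
exists k1; split=> // k kK kk0; split; last by move=> ->; exists x'.
case=> x2 [x2_ge0 x20 x2b].
pose u := x2 k0.
(* Any other solution supported on [K] lies on the line, its parameter [u] being its coefficient at
   [k0]. *)
have x2E e : x2 e = x e + u * y e.
  apply/eqP; rewrite -subr_eq0; apply/eqP.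
  apply: (feasible_free (y := fun e => x2 e - (x e + u * y e)) cJ x0 xb) => [f|].
    rewrite !inE negb_and negbK => /orP[/eqP->|fK].
      by rewrite xk0 yk0 mulr1 add0r subrr.
    by rewrite x20 ?x0 ?y0 ?inE ?(negPf fK) ?andbF // mulr0 addr0 subr0.
  under eq_bigr do rewrite scalerBl scalerDl -scalerA.
  by rewrite sumrB big_split /= -scaler_sumr yb xb x2b scaler0 addr0 subrr.
have u_ge0 : 0 <= u by apply: x2_ge0.
have x2k : x k + u * y k = 0 by rewrite -x2E x20 // !inE eqxx.
have xk : 0 < x k by apply: x_gt0; rewrite !inE kk0.
have yk : y k < 0.
  rewrite ltNge; apply/negP => yk; have := mulr_ge0 u_ge0 yk; lra.
have tu : t = u.
  apply/eqP; rewrite eq_le; apply/andP; split.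
    apply: le_trans (k1min k yk) _; rewrite ler_pdivrMr ?oppr_gt0 //; lra.
  have := x2_ge0 k1; rewrite x2E /t ler_pdivlMr ?oppr_gt0 //; lra.
apply/eqP/negPn/negP => kk1.
have := feasible_support (cKk _ k1K) x'0 x'b (e := k).
by rewrite !inE kk1 kK /x' tu x2k eqxx => /(_ isT).
Qed.

(** Feasible facets of [K] come in pairs, the two ends of the segment: feasibility is a cocycle
    modulo 2. *)
Lemma pivot_parity (K : {set E}) : #|K| = n.+1 ->
  \big[addb/false]_(k in K) `[< feasible (K :\ k) >] = false.
Proof.
move=> cK; rewrite (xor_card (mem K) (fun k => `[< feasible (K :\ k) >])) /=.
set X := [set _ | _].
have [->|[k0]] := set_0Vmem X; first by rewrite cards0.
rewrite inE => /andP[k0K /asboolP f0].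
have [k1 [k1K k10 hk1]] := pivot cK k0K f0.
have -> : X = [set k0; k1].
  apply/setP => k; rewrite !inE; apply/andP/orP.
    case=> kK /asboolP fk; have [->|kk0] := eqVneq k k0; first by left.
    by right; apply/eqP/(hk1 k kK kk0).
  case=> /eqP->; first by split=> //; apply/asboolP.
  by split=> //; apply/asboolP/hk1.
by rewrite cards2 eq_sym k10.
Qed.

End Pivot.

(** * Pairing the dominating chain with the feasible cochain *)

Section Scarf.
Variables (R : realFieldType) (n : nat) (E : finType).
Variables (B : E -> 'cV[R]_n) (b : 'cV[R]_n).
Hypothesis n_gt1 : (1 < n)%N.
Hypothesis pointed : forall y : E -> R, (forall e, 0 <= y e) ->
  \sum_e y e *: B e = 0 -> forall e, y e = 0.
Hypothesis b_gen : forall x : E -> R, \sum_e x e *: B e = b ->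
  (n <= #|[set e | (x e != 0)%R]|)%N.
Variables (c : 'I_n -> E -> nat) (s : 'I_n -> E).
Hypothesis c_inj : forall i, injective (c i).
Hypothesis s_inj : injective s.
Hypothesis s_top : forall i e, (c i e <= c i (s i))%N.
Hypothesis s_low : forall i k e, e \notin codom s -> i != k ->
  (c k (s i) < c k e)%N.

Let f (J : {set E}) := `[< feasible B b J >].

(* Adding a fixed slack [s i0] turns the cocycle condition [pivot_parity] into
   an explicit primitive of [f]. *)
Let primitive i0 (W : {set E}) := (s i0 \notin W) && f (s i0 |: W).

(** If [J] contains [s i0], only the term [j = s i0] survives, and it is [f J]. Otherwise the sum
    consists of the terms of [pivot_parity] for [s i0 |: J] other than [f J]. *)
Let f_coboundary i0 (J : {set E}) : #|J| = n ->
  f J = \big[addb/false]_(j in J) primitive i0 (J :\ j).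
Proof.
move=> cJ; rewrite /primitive; have [sJ|sJ] := boolP (s i0 \in J).
  rewrite (bigD1 (s i0)) //= big1 ?addbF.
    by rewrite !inE eqxx /= finset.setD1K.
  by move=> j /andP[jJ js]; rewrite !inE eq_sym js sJ.
have cK : #|s i0 |: J| = n.+1 by rewrite cardsU1 sJ add1n cJ.
have := pivot_parity pointed b_gen cK.
rewrite (bigD1 (s i0)) ?setU11 //= finset.setU1K // -/(f J).
set S := \big[_/_]_(_ | _) _ => fS; have -> : f J = S by case: (f J) S fS => [] [].
apply: eq_big => j.
  by rewrite !inE; have [->|] := eqVneq j (s i0); rewrite ?(negPf sJ) ?andbT ?andbF.
rewrite !inE => /andP[_ js]; rewrite eq_sym (negPf js) (negPf sJ) /=.
congr `[< feasible B b _ >].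
apply/setP => e; rewrite !inE; have [->|] := eqVneq e (s i0) => //=.
by rewrite eq_sym js.
Qed.

(** The number of sets both dominating and feasible is odd: its parity is the pairing of the
    coboundary [f] with the dominating chain, hence of [primitive i0] with the boundary of the slack
    simplex, which is [f S]. *)
Theorem scarf : feasible B b [set s i | i : 'I_n] ->
  exists J : {set E}, [/\ #|J| = n, dominating c J & feasible B b J].
Proof.
move=> fS; set S := [set s i | i : 'I_n] in fS *.
have i0 : 'I_n by exact: Ordinal (ltnW n_gt1).
suff : \big[addb/false]_(J : {set E} | (#|J| == n) && dominating c J) f J.
  apply: contraPP => h; rewrite big1 // => J /andP[/eqP cJ dJ].
  by apply/asboolP => fJ; apply: h; exists J.
under eq_bigr => J /andP[/eqP cJ _] do rewrite (f_coboundary i0 cJ).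
rewrite pair_big_dep /=.
(* Summation by parts: a set [J] with an element [j] becomes a wall [W] with an added element [e],
   where [J = e |: W]. *)
rewrite (reindex_onto (fun p : {set E} * E => (p.2 |: p.1, p.2))
                      (fun p => (p.1 :\ p.2, p.2))) /=; last first.
  by case=> J j /= /andP[_ jJ]; rewrite finset.setD1K.
rewrite (eq_bigl (fun p : {set E} * E => (#|p.1|.+1 == n) &&
  ((p.2 \notin p.1) && dominating c (p.2 |: p.1)))); last first.
  case=> W e /=; rewrite setU11 cardsU1 xpair_eqE eqxx !andbT.
  have [eW|eW] := boolP (e \in W); last by rewrite finset.setU1K // eqxx !andbT.
  rewrite andbF; apply/negbTE; rewrite negb_and; apply/orP; right.
  by apply/eqP/setP => /(_ e); rewrite !inE eqxx eW.
rewrite -(pair_big_dep (fun W : {set E} => #|W|.+1 == n)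
  (fun W e => (e \notin W) && dominating c (e |: W))
  (fun W e => primitive i0 ((e |: W) :\ e))) /=.
have -> : \big[addb/false]_(W : {set E} | #|W|.+1 == n)
    \big[addb/false]_(e | (e \notin W) && dominating c (e |: W))
      primitive i0 ((e |: W) :\ e) =
  \big[addb/false]_(W : {set E} | #|W|.+1 == n)
    (primitive i0 W && [exists k, W == S :\ s k]).
  apply: eq_bigr => W /eqP cW.
  rewrite -(wall_parity n_gt1 c_inj s_inj s_top s_low cW).
  rewrite big_mkcondr big_distrr /=; apply: eq_bigr => e eW.
  by rewrite finset.setU1K //; case: dominating; rewrite ?andbT ?andbF.
have cS k : #|S :\ s k|.+1 == n.
  have := cardsD1 (s k) S; rewrite card_imset // card_ord => ->.
  by rewrite imset_f.
(* All other walls of the slack simplex contain [s i0], so [primitive i0] vanishes on them. *)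
rewrite (bigD1 (S :\ s i0)) //= big1 ?addbF.
  apply/andP; split; last by apply/existsP; exists i0.
  by rewrite /primitive !inE eqxx /= finset.setD1K ?imset_f //; apply/asboolP.
move=> W /andP[_ WS]; apply/negbTE; rewrite negb_and -implybE.
apply/implyP => /andP[sW _]; apply/existsPn => k; apply: contraNneq sW => WE.
rewrite WE !inE imset_f // andbT; apply: contraNneq WS => sk.
by rewrite WE -sk.
Qed.
End Scarf.

(** * Generic positions *)

(** Ties are broken by the position in a sorted enumeration; [scarf] needs injective rankings. *)
Lemma order_refinement (d : Order.disp_t) (T : orderType d) (E : finType)
    (v : E -> T) :
  exists r : E -> nat, injective r /\ forall e f, (v e < v f)%O -> (r e < r f)%N.
Proof.
pose le e f := (v e <= v f)%O; pose s := sort le (enum E).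
have sE e : e \in s by rewrite mem_sort mem_enum.
have le_tr : transitive le by move=> x y z; apply: le_trans.
have s_sorted : sorted le s by apply: sort_sorted => e f; apply: le_total.
exists (index^~ s); split=> [e f ef|e f].
  by rewrite -(nth_index e (sE e)) ef nth_index.
apply: contraTT; rewrite -leqNgt -leNgt.
exact: (sorted_leq_index le_tr (fun e => lexx (v e)) s_sorted).
Qed.

(** The point is taken on the moment curve [s ^+ i]. Fewer than [n] vectors lie in a hyperplane,
    which the curve meets only at roots of a nonzero polynomial; [s] avoids the roots of the product
    [P] of these polynomials. *)
Lemma generic_point (R : realFieldType) (n : nat) (E : finType)
    (B : E -> 'cV[R]_n) :
  exists b : 'cV[R]_n, (forall i, 1 <= b i 0 <= 2 ^+ n) /\
    forall x : E -> R, \sum_e x e *: B e = b ->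
      (n <= #|[set e | (x e != 0)%R]|)%N.
Proof.
pose normal (W : {set E}) (h : 'rV[R]_n) :=
  h != 0 /\ forall e, e \in W -> h *m B e = 0.
have /choice[h hP] (W : {set E}) : exists h, (#|W| < n)%N -> normal W h.
  have [Wn|_] := ltnP #|W| n; last by exists 0.
  pose M := \matrix_(i < n, j < #|W|) B (enum_val j) i 0.
  have : kermx M != 0.
    rewrite kermx_eq0 -row_leq_rank -ltnNge.
    exact: leq_ltn_trans (rank_leq_col M) Wn.
  case/rowV0Pn => u /sub_kermxP uM0 u0; exists u => _; split=> // e eW.
  have -> : B e = col (enum_rank_in eW e) M.
    by apply/matrixP => i j; rewrite !mxE enum_rankK_in // ord1.
  by rewrite colE mulmxA uM0 mul0mx.
pose p (W : {set E}) := \poly_(i < n) (if insub i is Some j then h W 0 j else 0).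
have pE W s : (p W).[s] = \sum_(i < n) h W 0 i * s ^+ i.
  by rewrite horner_poly; apply: eq_bigr => i _; rewrite valK.
pose P := \prod_(W : {set E} | (#|W| < n)%N) p W.
have P0 : P != 0.
  apply/prodf_neq0 => W /hP[/rV0Pn[i hi] _]; apply: contraNneq hi => pW.
  have := coef_poly n (fun i => if insub i is Some j then h W 0 j else 0) i.
  by rewrite -/(p W) pW coef0 ltn_ord valK => <-.
pose N := size P.
have N_gt0 : 0 < N%:R :> R by rewrite ltr0n lt0n size_poly_eq0.
(* These [size P] distinct points of [[1, 2]] outnumber the degree of [P], so they are not all
   roots. *)
pose pts := [seq 1 + k%:R / N%:R : R | k <- iota 0 N].
have [s spts Ps] : exists2 s, s \in pts & ~~ root P s.
  apply/hasP; rewrite has_predC; apply/negP => /(max_poly_roots P0).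
  rewrite size_map size_iota ltnn => hu; suff /hu : uniq pts by [].
  rewrite map_inj_uniq ?iota_uniq // => i j /addrI /(divIf (lt0r_neq0 N_gt0)).
  by move/eqP; rewrite eqr_nat => /eqP.
have {spts} /andP[s_ge1 s_le2] : 1 <= s <= 2.
  case/mapP: spts => k; rewrite mem_iota /= add0n => kN ->.
  rewrite lerDl divr_ge0 ?ler0n //= (_ : 2 = 1 + 1) // lerD2l.
  by rewrite ler_pdivrMr // mul1r ler_nat ltnW.
exists (\col_i s ^+ i); split=> [i|x xb].
  rewrite mxE exprn_ege1 //= (le_trans (y := 2 ^+ i)) ?lerXn2r ?nnegrE //; try lra.
  by rewrite ler_weXn2l ?ler1n // ltnW.
rewrite leqNgt; apply/negP => Wn; set W := [set _ | _] in Wn.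
have [_ hW] := hP W Wn.
case/negP: Ps; rewrite /root horner_prod prodf_seq_eq0.
apply/hasP; exists W; rewrite ?mem_index_enum // Wn /= pE.
have -> : \sum_(i < n) h W 0 i * s ^+ i = (h W *m \col_i s ^+ i) 0 0.
  by rewrite mxE; apply: eq_bigr => i _; rewrite mxE.
rewrite -xb mulmx_sumr big1 ?mxE // => e _; rewrite -scalemxAr.
have [eW|] := boolP (e \in W); first by rewrite hW // scaler0.
by rewrite inE negbK => /eqP ->; rewrite scale0r.
Qed.

(** Take [l] on the grid of coordinates [1 + j / N]. For fixed [m] let [k] maximise [|w m k|]: when
    only [l k] varies, distinct grid values change the form by at least [|w m k| / N], so at most
    one of the [N + 1] values is bad. Then [N] bad sets of density at most [1 / (N + 1)] cannot
    cover the grid. *)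
Lemma avoiding_functional (R : realFieldType) (n : nat) (I : finType)
    (w : I -> 'I_n -> R) : (0 < #|I|)%N ->
  exists l : 'I_n -> R, (forall i, 1 <= l i <= 2) /\
    forall m k, `|w m k| / (3 * #|I|%:R) <= `|\sum_i l i * w m i|.
Proof.
move=> I_gt0; set N := #|I| in I_gt0 *.
have N_gt0 : 0 < N%:R :> R by rewrite ltr0n.
have [n0|/lt0n_neq0 n0] := posnP n.
  by exists (fun=> 1); split=> [[i hi]|m [i hi]]; exfalso; rewrite n0 in hi.
pose G := {ffun 'I_n -> 'I_N.+1}.
pose lam (x : G) i : R := 1 + (x i)%:R / N%:R.
have lam12 x i : 1 <= lam x i <= 2.
  rewrite lerDl divr_ge0 ?ler0n //= (_ : 2 = 1 + 1) // lerD2l.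
  by rewrite ler_pdivrMr // mul1r ler_nat -ltnS.
pose bad m := [set x : G | [exists k,
  `|\sum_i lam x i * w m i| < `|w m k| / (3 * N%:R)]].
have bad_card m : (N.+1 * #|bad m| <= #|G|)%N.
  have k0 : 'I_n by case: (n) n0 => // n' _; exact: ord0.
  pose k := [arg max_(k > k0) `|w m k|]%O.
  have kmax j : `|w m j| <= `|w m k|.
    by rewrite /k; case: arg_maxP => // i _; apply.
  have badk x : x \in bad m -> `|\sum_i lam x i * w m i| < `|w m k| / (3 * N%:R).
    rewrite inE => /existsP[j /lt_le_trans]; apply.
    by rewrite ler_pM2r ?kmax // invr_gt0 mulr_gt0.
  (* Overwriting coordinate [k] is injective on pairs of a value and a bad point, because bad points
     that agree off [k] are equal. *)
  pose upd (p : 'I_N.+1 * G) : G := [ffun i => if i == k then p.1 else p.2 i].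
  have -> : (N.+1 * #|bad m|)%N = #|finset.setX [set: 'I_N.+1] (bad m)|.
    by rewrite cardsX cardsT card_ord.
  rewrite -(card_in_imset (f := upd)) ?max_card // => -[t x] [t' y].
  rewrite !inE /= => bx0 by0.
  have {bx0}bx : x \in bad m by rewrite inE.
  have {by0}by' : y \in bad m by rewrite inE.
  move=> /ffunP upd_eq.
  have -> : t = t' by have := upd_eq k; rewrite !ffunE eqxx.
  have xy i : i != k -> x i = y i.
    by move=> ik; have := upd_eq i; rewrite !ffunE (negPf ik).
  congr (_, _); apply/ffunP => i; have [->|/xy//] := eqVneq i k.
  apply/eqP/negPn/negP => xyk.
  have : `|w m k| / N%:R <= `|\sum_i lam x i * w m i - \sum_i lam y i * w m i|.
    rewrite -sumrB (bigD1 k) //= big1 ?addr0 => [|j jk]; last first.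
      by rewrite /lam xy // subrr.
    rewrite -mulrBl normrM mulrC ler_wpM2r //.
    rewrite /lam opprD addrACA subrr add0r -mulrBl normrM [`|_^-1|]gtr0_norm ?invr_gt0 //.
    rewrite ler_pMl ?invr_gt0 //.
    have -> : (x k)%:R - (y k)%:R = ((x k)%:Z - (y k)%:Z)%:~R :> R.
      by rewrite intrB.
    rewrite -intr_norm -[1]/(1%:~R) ler_int -gtz0_ge1 normr_gt0 subr_eq0.
    by rewrite eqz_nat.
  apply/negP; rewrite -ltNge (le_lt_trans (ler_normB _ _)) //.
  have := badk _ bx; have := badk _ by'.
  rewrite (_ : `|w m k| / (3 * N%:R) = `|w m k| / N%:R / 3); last by field; rewrite lt0r_neq0.
  have : 0 <= `|w m k| / N%:R by rewrite divr_ge0 // ltW.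
  lra.
have : (#|\bigcup_m bad m| < #|G|)%N.
  rewrite -(ltn_pmul2l (ltn0Sn N)).
  have : (N.+1 * #|\bigcup_m bad m| <= N * #|G|)%N.
    apply: (@leq_trans (N.+1 * \sum_m #|bad m|)).
      rewrite leq_mul2l /=; elim/big_rec2: _ => [|i x y _ xy]; first by rewrite cards0.
      by apply: leq_trans (leq_card_setU _ _) _; rewrite leq_add2l.
    rewrite big_distrr /= (leq_trans (leq_sum _ (fun m _ => bad_card m))) //.
    by rewrite sum_nat_const.
  move/leq_ltn_trans; apply; rewrite ltn_pmul2r //.
  by apply/card_gt0P; exists [ffun=> ord0].
rewrite -cardsT => lt; have /subsetPn[x _ xbad] : ~~ ([set: G] \subset \bigcup_m bad m).
  by apply: contraL lt => /subset_leq_card; rewrite -leqNgt.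
exists (lam x); split=> // m k; rewrite leNgt; apply: contra xbad => h.
by apply/bigcupP; exists m => //; rewrite inE; apply/existsP; exists k.
Qed.

(** * Lattice vectors *)

(** Bernoulli gives [q ^+ m >= m * (q - 1)]; with [L = m * (d + 1)], [q ^+ L] is at least of order
    [m ^+ d.+1]. *)
Lemma exp_dominates_poly (R : archiRealFieldType) (q M : R) (d : nat) : 1 < q ->
  exists L : nat, M * L.+1%:R ^+ d <= q ^+ L.
Proof.
move=> q1; pose e := q - 1; have e_gt0 : 0 < e by rewrite subr_gt0.
have bern m : m%:R * e <= q ^+ m.
  have -> : q = 1 + e by rewrite /e addrCA subrr addr0.
  elim: m => [|m IH]; first by rewrite mul0r exprn_ge0 // addr_ge0 // ltW.
  rewrite exprS -natr1 mulrDl mul1r [leRHS]mulrDl mul1r lerD // ler_peMr ?(ltW e_gt0) //.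
  by rewrite exprn_ege1 // lerDl ltW.
pose D : R := d.+2%:R ^+ d.
have D_gt0 : 0 < D by rewrite exprn_gt0.
pose k := `|M| * D / e ^+ d.+1.
have k_ge0 : 0 <= k by rewrite divr_ge0 ?mulr_ge0 ?exprn_ge0 // ltW.
pose m := (Num.truncn k).+1.
have km : k <= m%:R by have /andP[_ /ltW] := truncn_itv k_ge0.
exists (m * d.+1)%N; apply: (@le_trans _ _ (`|M| * (D * m%:R ^+ d))).
  apply: (@le_trans _ _ (`|M| * (m * d.+1).+1%:R ^+ d)).
    by rewrite ler_wpM2r ?ler_norm ?exprn_ge0.
  rewrite ler_wpM2l // /D -exprMn -natrM lerXn2r ?nnegrE // ler_nat.
  by rewrite /m; nia.
apply: (@le_trans _ _ ((m%:R * e) ^+ d.+1)); last first.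
  have q_ge0 : 0 <= q by apply: ltW; apply: lt_trans q1.
  rewrite exprM lerXn2r ?nnegrE ?bern ?exprn_ge0 //.
  by rewrite mulr_ge0 // (ltW e_gt0).
have -> : (m%:R * e) ^+ d.+1 = m%:R * e ^+ d.+1 * m%:R ^+ d.
  by rewrite exprMn (exprS m%:R); ring.
rewrite mulrA ler_wpM2r ?exprn_ge0 //.
by move: km; rewrite /k ler_pdivrMr ?exprn_gt0.
Qed.

(** Pigeonhole: there are [(Q + 1)^(n + 1)] integer points with coordinates in [0..Q], and their
    images fall into at most [(3 * A * Q / h)^n <= Q^(n + 1)] cells of side [h] in the coordinates
    other than [i0]. The difference of two points in one cell is thin. *)
Lemma thin_lattice_vector (R : archiRealFieldType) (n : nat) (g : 'M[R]_n.+1) :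
  exists2 A : R, 1 <= A & forall (Q : nat) (h : R) (i0 : 'I_n.+1),
    0 < h <= A * Q%:R -> (3 * A) ^+ n <= Q%:R * h ^+ n ->
    exists z : 'cV[int]_n.+1, [/\ z != 0,
      `|(g *m map_mx intr z) i0 0| <= A * Q%:R &
      forall k, k != i0 -> `|(g *m map_mx intr z) k 0| < h].
Proof.
pose A : R := 1 + \sum_i \sum_j `|g i j|.
have A_ge1 : 1 <= A by rewrite lerDl sumr_ge0 // => i _; rewrite sumr_ge0.
have A_gt0 : 0 < A by apply: lt_le_trans A_ge1.
have gA (z : 'cV[int]_n.+1) (c : R) i :
    (forall j, `|(z j 0)%:~R : R| <= c) -> `|(g *m map_mx intr z) i 0| <= A * c.
  move=> zc; have c_ge0 : 0 <= c by apply: le_trans (zc ord0).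
  rewrite mxE (le_trans (ler_norm_sum _ _ _)) //.
  apply: (@le_trans _ _ (\sum_j `|g i j| * c)).
    by apply: ler_sum => j _; rewrite mxE normrM ler_wpM2l.
  rewrite -mulr_suml ler_wpM2r // /A [X in _ <= 1 + X](bigD1 i) //= addrCA lerDl addr_ge0 //.
  by rewrite sumr_ge0 // => k _; rewrite sumr_ge0.
exists A => // Q h i0 /andP[h_gt0 hAQ] hQ.
set T := A * Q%:R in hAQ *.
have T_gt0 : 0 < T by apply: lt_le_trans hAQ.
pose P := Num.truncn (2 * T / h).
have Th_ge0 : 0 <= 2 * T / h by rewrite divr_ge0 ?mulr_ge0 // ltW.
have PT : P.+1%:R <= 3 * T / h.
  have /andP[PT _] := truncn_itv Th_ge0.
  rewrite -natr1 -/P; have : 1 <= T / h by rewrite ler_pdivlMr // mul1r.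
  move: PT; rewrite -/P -!mulrA; lra.
have Q_gt0 : 0 < Q%:R :> R by move: T_gt0; rewrite /T pmulr_rgt0.
pose zof (x : {ffun 'I_n.+1 -> 'I_Q.+1}) : 'cV[int]_n.+1 := \col_j (x j)%:Z.
have zQ x i : `|(g *m map_mx intr (zof x)) i 0| <= T.
  by apply: gA => j; rewrite mxE pmulrn -pmulrn normr_nat ler_nat -ltnS.
pose pos x k := ((g *m map_mx intr (zof x)) k 0 + T) / h.
have pos_ge0 x k : 0 <= pos x k.
  rewrite divr_ge0 ?(ltW h_gt0) //; by have := zQ x k; rewrite ler_norml -lerBlDr sub0r => /andP[].
pose cell (x : {ffun 'I_n.+1 -> 'I_Q.+1}) : {ffun 'I_n -> 'I_P.+1} :=
  [ffun k => inord (Num.truncn (pos x (lift i0 k)))].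
have : ~ injective cell.
  move/leq_card; rewrite !card_ffun !card_ord leqNgt => /negP; apply.
  rewrite -(ltr_nat R) !natrX (@le_lt_trans _ _ ((3 * T / h) ^+ n)) //.
    by rewrite lerXn2r ?nnegrE // (le_trans _ PT).
  rewrite expr_div_n ltr_pdivrMr ?exprn_gt0 // /T mulrA exprMn exprSr.
  apply: (@le_lt_trans _ _ (Q%:R ^+ n * (Q%:R * h ^+ n))).
    by rewrite mulrC ler_wpM2l ?exprn_ge0 // ltW.
  by rewrite mulrA ltr_pM2r ?exprn_gt0 // -!exprSr -!natrX ltr_nat ltn_exp2r.
move=> ninj; have [x [y [xy cxy]]] : exists x y, x != y /\ cell x = cell y.
  apply: contrapT => hne; apply: ninj => x y cxy; apply/eqP/negPn/negP => xy.
  by apply: hne; exists x, y.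
exists (zof x - zof y); split.
- rewrite subr_eq0; apply: contraNneq xy => zxy; apply/eqP/ffunP => j.
  move/matrixP/(_ j 0): zxy; rewrite !mxE => /eqP; rewrite eqz_nat => /eqP.
  exact: val_inj.
- apply: gA => j; rewrite !mxE -intr_norm [leRHS]pmulrn ler_int ler_norml.
  have xQ (u : 'I_Q.+1) : (u%:Z <= Q%:Z)%R by rewrite lez_nat -ltnS.
  have x_ge0 (u : 'I_Q.+1) : (0 <= u%:Z)%R by [].
  apply/andP; split.
    by apply: (@le_trans _ _ (- (y j)%:Z)); rewrite ?lerN2 ?xQ ?lerDr ?x_ge0.
  by apply: (@le_trans _ _ (x j)%:Z); rewrite ?gerBl ?xQ ?x_ge0.
- move=> k; case: (unliftP i0 k) => [j -> _|->]; last by rewrite eqxx.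
  have pos_lt u : (Num.truncn (pos u (lift i0 j)) < P.+1)%N.
    rewrite ltnS le_truncn // ler_pM2r ?invr_gt0 // mulrDl mul1r lerD2r.
    by have := zQ u (lift i0 j); rewrite ler_norml => /andP[].
  have tE : Num.truncn (pos x (lift i0 j)) = Num.truncn (pos y (lift i0 j)).
    have /ffunP/(_ j)/(congr1 val) := cxy.
    by rewrite !ffunE /= !inordK ?pos_lt.
  have -> : (g *m map_mx intr (zof x - zof y)) (lift i0 j) 0 =
      (pos x (lift i0 j) - pos y (lift i0 j)) * h.
    rewrite map_mxB mulmxBr mxE [X in _ + X]mxE -mulrBl divfK ?lt0r_neq0 //.
    by rewrite opprD addrACA subrr addr0.
  rewrite normrM (gtr0_norm h_gt0) -[ltRHS]mul1r ltr_pM2r // ltr_norml.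
  have /andP[] := truncn_itv (pos_ge0 x (lift i0 j)).
  have /andP[] := truncn_itv (pos_ge0 y (lift i0 j)).
  rewrite tE -natr1; lra.
Qed.

(** Some entry of [z], the image of the lattice vector under [invmx g], is at least 1 in absolute
    value; so the vector has an entry of at least [A^-1]. *)
Lemma lattice_separation (R : realType) (n : nat) (g : 'M[R]_n) : \det g = 1 ->
  exists2 r : R, 0 < r <= 1 & forall z : 'cV[int]_n, z != 0 ->
    exists k, r <= `|(g *m map_mx intr z) k 0|.
Proof.
move=> g1; have gU : g \in unitmx by rewrite unitmxE g1 unitr1.
pose A : R := 1 + \sum_i \sum_j `|invmx g i j|.
have A_gt0 : 0 < A.
  by rewrite ltr_pwDl // sumr_ge0 // => i _; rewrite sumr_ge0.
exists A^-1 => [|z].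
  rewrite invr_gt0 A_gt0 invf_le1 // lerDl sumr_ge0 // => i _.
  by rewrite sumr_ge0.
case/cV0Pn => i zi; apply: contrapT => /forallNP hk.
set v := g *m map_mx intr z in hk.
have : (1 : R) <= `|(z i 0)%:~R| by rewrite -intr_norm ler1z -gtz0_ge1 normr_gt0.
have -> : (z i 0)%:~R = (invmx g *m v) i 0 by rewrite mulKmx // mxE.
apply/negP; rewrite -ltNge mxE (le_lt_trans (ler_norm_sum _ _ _)) //.
apply: (@le_lt_trans _ _ ((A - 1) * A^-1)).
  have -> : A - 1 = \sum_k \sum_j `|invmx g k j| by rewrite /A addrAC subrr add0r.
  rewrite [X in _ <= X * _](bigD1 i) //= mulrDl ler_wpDr //.
    rewrite mulr_ge0 ?invr_ge0 ?(ltW A_gt0) // sumr_ge0 // => k _.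
    by rewrite sumr_ge0.
  rewrite mulr_suml ler_sum // => j _; rewrite normrM ler_wpM2l //.
  by have /negP := hk j; rewrite -ltNge => /ltW.
by rewrite mulrBl divff ?lt0r_neq0 // mul1r gtrBl invr_gt0.
Qed.

(** * Boxes with independent lattice vectors *)

Lemma geometric_round_up (R : realFieldType) (t q x : R) (L : nat) :
  0 < t -> 1 < q -> x <= t * q ^+ L ->
  exists k : 'I_L.+1, x <= t * q ^+ k <= q * Num.max x t.
Proof.
move=> t_gt0 q_gt1 xL; have q_gt0 : 0 < q by apply: lt_trans q_gt1.
have ex : exists k, x <= t * q ^+ k by exists L.
case: (ex_minnP ex) => k xk kmin; have kL := kmin _ xL.
exists (Ordinal (kL : (k < L.+1)%N)); rewrite xk /=.
case: k xk kmin {kL} => [_ _|k _ kmin].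
  by rewrite expr0 mulr1 (le_trans (y := Num.max x t)) ?le_max ?lexx ?orbT //
    ler_peMl ?ltW // lt_max t_gt0 orbT.
rewrite exprS mulrCA ler_pM2l // le_max; apply/orP; left; apply: ltW.
by rewrite ltNge; apply/negP => /kmin; rewrite ltnn.
Qed.

Section Box.
Variables (R : realType) (n : nat) (g : 'M[R]_n.+1) (q : R).
Hypothesis n_gt0 : (0 < n)%N.
Hypothesis q_gt1 : 1 < q.

Let lat (z : 'cV[int]_n.+1) : 'cV[R]_n.+1 := g *m map_mx intr z.

(* [G] indexes the boxes with half-sides [t * q ^+ k], [k <= L]; for each of
   them one lattice vector is kept. *)
Variables (r t : R) (L : nat).
Let G : finType := {ffun 'I_n.+1 -> 'I_L.+1}.
Let N : R := #|G|%:R.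
Let T := t * q ^+ L.
Let eta := 2 * q * t.
Hypothesis r_gt0 : 0 < r.
Hypothesis t_gt0 : 0 < t.
Hypothesis lat_sep : forall z, z != 0 -> exists k, r <= `|lat z k 0|.
(** In the proof below [ell b] is at most [n.+1 * 2 ^+ n.+2] and each kept vector has
    [|ell| >= r / (3 * N)]. Hence kept vectors with [k]-th entry at most [eta] contribute at most
    1/2 to the [k]-th coordinate of [b]. *)
Hypothesis etaE : eta * (n.+1%:R * 2 ^+ n.+2 * (6 * N)) = r.
Hypothesis thin : forall i0, exists z, [/\ z != 0, `|lat z i0 0| <= T &
  forall k, k != i0 -> `|lat z k 0| < t].
Hypothesis tT : t <= T.

Let q_gt0 : 0 < q. Proof. exact: lt_trans q_gt1. Qed.
Let eta_gt0 : 0 < eta. Proof. by rewrite !mulr_gt0. Qed.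
Let N_gt0 : 0 < N.
Proof. by rewrite ltr0n; apply/card_gt0P; exists [ffun=> ord0]. Qed.

(** A grid box without nonzero lattice vector gets a thin vector as placeholder. Rounding
    coordinates up to the grid costs a factor [q], those below [t] counting as [t]. *)
Let netP : exists zz : G -> 'cV[int]_n.+1, [/\ forall m, zz m != 0,
  forall m k, `|lat (zz m) k 0| <= T &
  forall z, z != 0 -> (forall k, `|lat z k 0| <= T) ->
    exists m, forall k, `|lat (zz m) k 0| <= q * Num.max `|lat z k 0| t].
Proof.
pose small (m : G) z := z != 0 /\ forall k, `|lat z k 0| <= t * q ^+ m k.
have /choice[zz zzP] (m : G) : exists z, [/\ z != 0,
    forall k, `|lat z k 0| <= T & (exists z', small m z') -> small m z].
  have [[z [z0 hz]]|no] := pselect (exists z, small m z).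
    exists z; split=> // k; rewrite (le_trans (hz k)) // ler_pM2l //.
    by rewrite ler_weXn2l ?(ltW q_gt1) // -ltnS.
  have [z [z0 zi zk]] := thin ord0; exists z; split=> // k.
  by have [->//|/zk/ltW/le_trans->] := eqVneq k ord0.
exists zz; split=> [m|m|z z0 zT]; [by case: (zzP m)|by case: (zzP m)|].
have /choice[m0 m0P] k := geometric_round_up t_gt0 q_gt1 (zT k).
pose m : G := [ffun k => m0 k]; exists m => k.
have [_ _ []] := zzP m.
  by exists z; split=> // j; rewrite ffunE; case/andP: (m0P j).
move=> _ /(_ k) /le_trans; apply; rewrite ffunE.
by case/andP: (m0P k).
Qed.

Lemma box_of_scales : exists (a : 'I_n.+1 -> R) (Z : 'M[int]_n.+1),
  [/\ forall i, 0 < a i, \det Z != 0,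
      forall i j, `|(g *m map_mx intr Z) i j| <= a i &
      forall z, z != 0 -> exists i, a i <= q * `|lat z i 0| ].
Proof.
have [zz [zz0 zzT net]] := netP.
pose v m := lat (zz m).
have G_gt0 : (0 < #|G|)%N by apply/card_gt0P; exists [ffun=> ord0].
have [l [l12 hl]] := avoiding_functional (fun m i => v m i 0) G_gt0.
pose ell (y : 'cV[R]_n.+1) := \sum_i l i * y i 0.
have l_gt0 i : 0 < l i by case/andP: (l12 i) => /(lt_le_trans ltr01).
have ell_v m : r / (3 * N) <= `|ell (v m)|.
  have [k rk] := lat_sep (zz0 m); apply: le_trans (hl m k).
  by rewrite ler_pM2r // invr_gt0 mulr_gt0.
(* The elements are the slacks, as unit vectors, and the kept vectors, signed so that [ell] is
   positive; this makes the cone pointed. *)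
pose E : finType := ('I_n.+1 + G)%type.
pose B (e : E) := match e with
  | inl i => delta_mx i 0 | inr m => Num.sg (ell (v m)) *: v m end.
have ellZ c y : ell (c *: y) = c * ell y.
  by rewrite /ell mulr_sumr; apply: eq_bigr => i _; rewrite mxE mulrCA.
have ell_sum (y : E -> R) : ell (\sum_e y e *: B e) = \sum_e y e * ell (B e).
  rewrite /ell; under eq_bigr do rewrite summxE mulr_sumr.
  rewrite exchange_big; apply: eq_bigr => e _.
  by rewrite -ellZ.
have ellB_inr m : r / (3 * N) <= ell (B (inr m)).
  by rewrite /B ellZ -normrEsg.
have ellB_gt0 e : 0 < ell (B e).
  case: e => [i|m]; last first.
    by apply: lt_le_trans (ellB_inr m); rewrite divr_gt0 ?mulr_gt0.
  rewrite /ell (bigD1 i) //= mxE !eqxx mulr1 big1 ?addr0 // => j ji.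
  by rewrite mxE (negPf ji) mulr0.
have pointed (y : E -> R) : (forall e, 0 <= y e) ->
    \sum_e y e *: B e = 0 -> forall e, y e = 0.
  move=> y_ge0 yB e.
  have : \sum_e y e * ell (B e) = 0.
    rewrite -ell_sum yB /ell big1 // => i _; by rewrite mxE mulr0.
  move/psumr_eq0P => /(_ _ e isT) h; apply/eqP.
  have : y e * ell (B e) == 0.
    by apply/eqP/h => f _; rewrite mulr_ge0 // ltW.
  by rewrite mulf_eq0 (gt_eqF (ellB_gt0 e)) orbF.
have [b [b_bd b_gen]] := generic_point B.
have b_gt0 i : 0 < b i 0 by case/andP: (b_bd i) => /(lt_le_trans ltr01).
(* In ranking [i] the slack [i] exceeds all kept vectors, and the other slacks get [-1], below any
   absolute value, as [scarf] requires. *)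
pose big := 1 + T.
pose val i (e : E) := match e with
  | inl k => if k == i then big else -1 | inr m => `|v m i 0| end.
have T_ge0 : 0 <= T by apply: le_trans tT; exact: ltW.
have val_lt i e : e != inl i -> val i e < big.
  case: e => [k|m] ki /=.
    by rewrite ifN ?(inj_eq inl_inj) // /big; move: T_ge0; lra.
  by rewrite (le_lt_trans (zzT _ _)) // ltrDr.
have /choice[c cP] i := order_refinement (val i).
have c_inj i : injective (c i) by case: (cP i).
have c_mono i e f : val i e < val i f -> (c i e < c i f)%N.
  by case: (cP i) => _; apply.
have c_le i e f : (c i e <= c i f)%N -> val i e <= val i f.
  by rewrite leNgt; apply: contraL => /c_mono; rewrite -ltnNge.
pose s i : E := inl i.
have s_inj : injective s by apply: inl_inj.
have s_top i e : (c i e <= c i (s i))%N.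
  have [->//|ei] := eqVneq e (s i); apply/ltnW/c_mono.
  by rewrite /= eqxx val_lt.
have s_low i k e : e \notin codom s -> i != k -> (c k (s i) < c k e)%N.
  case: e => [j|m] es ik; first by rewrite codom_f in es.
  apply: c_mono; rewrite /= (negPf ik); exact: lt_le_trans (ltrN10 _) (normr_ge0 _).
have n_gt1 : (1 < n.+1)%N by [].
have f0 : feasible B b [set s i | i : 'I_n.+1].
  exists (fun e => if e is inl i then b i 0 else 0); split.
  - by case=> // i; apply: ltW.
  - by case=> // i; rewrite imset_f.
  - rewrite big_sumType /= [X in _ + X]big1 ?addr0; last first.
      by move=> m _; rewrite scale0r.
    apply/colP => i; rewrite summxE (bigD1 i) //= !mxE !eqxx mulr1 big1 ?addr0 //.
    by move=> j ji; rewrite !mxE eq_sym (negPf ji) mulr0.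
have [J [cJ /forallP domJ [x [x_ge0 x0 xb]]]] :=
  scarf n_gt1 pointed b_gen c_inj s_inj s_top s_low f0.
have x_sum : \sum_m x (inr m) <= (n.+1%:R * 2 ^+ n.+2) * (3 * N) / r.
  rewrite -[leRHS]mulrA -[_ * N / r]invf_div -ler_pdivrMr ?invr_gt0 ?divr_gt0 ?mulr_gt0 // invrK.
  apply: (@le_trans _ _ (ell b)).
    rewrite -xb ell_sum big_sumType /= mulr_suml ler_wpDl //.
      by apply: sumr_ge0 => i _; rewrite mulr_ge0 // (ltW (ellB_gt0 (inl i))).
    by apply: ler_sum => m _; rewrite ler_wpM2l // (ellB_inr m).
  rewrite /ell (le_trans (y := \sum_(i < n.+1) 2 ^+ n.+2)) //; last first.
    by rewrite sumr_const card_ord mulr_natl.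
  apply: ler_sum => i _; rewrite exprS; apply: ler_pM => //.
  - exact: ltW.
  - exact: ltW.
  - by case/andP: (l12 i).
  - by case/andP: (b_bd i).
have large k : inl k \notin J -> exists2 m, inr m \in J & eta <= `|v m k 0|.
  move=> kJ; apply: contrapT => /forall2NP hk.
  have vk m : inr m \in J -> `|v m k 0| <= eta.
    by move=> mJ; case: (hk m) => // /negP; rewrite -ltNge => /ltW.
  have : b k 0 <= (\sum_m x (inr m)) * eta.
    rewrite -xb summxE big_sumType /= big1 ?add0r => [|i _]; last first.
      have [<-|ki] := eqVneq k i; first by rewrite x0 // scale0r mxE.
      by rewrite !mxE (negPf ki) mulr0.
    rewrite mulr_suml; apply: ler_sum => m _; rewrite mxE [X in _ * X]mxE.
    have [mJ|mJ] := boolP (inr m \in J); last by rewrite x0 // !mul0r.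
    rewrite ler_wpM2l // (le_trans (ler_norm _)) // normrM normr_sg.
    by rewrite -[leRHS]mul1r; apply: ler_pM; rewrite ?ler0n ?lern1 ?leq_b1 // vk.
  apply/negP; rewrite -ltNge (@lt_le_trans _ _ 1) //; last first.
    by case/andP: (b_bd k).
  apply: (@le_lt_trans _ _ (1 / 2)); last lra.
  rewrite (le_trans (ler_wpM2r (ltW eta_gt0) x_sum)) // -etaE.
  rewrite le_eqVlt; apply/orP; left; apply/eqP; field.
  by rewrite nat1r (lt0r_neq0 N_gt0) !lt0r_neq0 ?exprn_gt0.
(* Domination gives a direction where [J] does not exceed [v m]. The slack of that direction is
   absent from [J], since it would be on top there. *)
have dom m : exists2 k, inl k \notin J &
    forall m', inr m' \in J -> `|v m' k 0| <= `|v m k 0|.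
  have /existsP[k /'forall_implyP hk] := domJ (inr m).
  exists k => [|m' /hk /c_le //].
  apply/negP => /hk /c_le /=; rewrite eqxx leNgt => /negP; apply.
  exact: (val_lt k (inr m)).
have qt : q * t < eta by rewrite /eta -mulrA ltr_pMl ?mulr_gt0 // ltr1n.
(* If the slack [k] were in [J], the net representative of a thin vector stretched along [k] would
   be at most [q * t < eta] in all other directions, while domination makes it reach [eta] in one of
   them. *)
have noslack k : inl k \notin J.
  apply/negP => kJ; have [z [z0 zk zj]] := thin k.
  have [|m hm] := net z z0.
    by move=> j; have [->//|/zj/ltW/le_trans->] := eqVneq j k.
  have [j jJ hj] := dom m; have jk : j != k by apply: contraNneq jJ => ->.
  have [m' m'J] := large _ jJ; apply/negP; rewrite -ltNge.
  apply: le_lt_trans (hj _ m'J) _; apply: le_lt_trans (hm j) _.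
  by rewrite max_r // ltW // zj.
pose a k := \big[Num.max/0]_(m | inr m \in J) `|v m k 0|.
have va m k : inr m \in J -> `|v m k 0| <= a k.
  by move=> mJ; apply: (le_bigmax_cond _ (fun m => `|v m k 0|)).
have a_eta k : eta <= a k.
  have [m mJ] := large _ (noslack k); move/le_trans; apply; exact: va.
have a_gt0 k : 0 < a k by apply: lt_le_trans (a_eta k).
have [mu [mu_inj muJ]] : exists mu : 'I_n.+1 -> G,
    injective mu /\ J = [set inr (mu j) | j : 'I_n.+1].
  pose GJ := [set m : G | inr m \in J].
  have JE : J = [set inr m | m in GJ].
    apply/setP => -[k|m].
      by rewrite (negPf (noslack k)); apply/esym/negP => /imsetP[].
    by rewrite mem_imset ?inE //; apply: inr_inj.
  have cGJ : #|GJ| = n.+1 by rewrite -cJ JE card_imset //; apply: inr_inj.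
  exists (fun j => enum_val (cast_ord (esym cGJ) j)); split.
    by move=> i j /enum_val_inj /cast_ord_inj.
  rewrite {1}JE; apply/setP => e; apply/imsetP/imsetP => -[m].
    move=> mJ ->; exists (cast_ord cGJ (enum_rank_in mJ m)) => //.
    by rewrite cast_ordK enum_rankK_in.
  by move=> _ ->; eexists; last reflexivity; apply: enum_valP.
have muJ' j : inr (mu j) \in J by rewrite muJ imset_f.
pose Z := \matrix_(i, j) zz (mu j) i 0.
have colZ j : col j (g *m map_mx intr Z) = v (mu j).
  rewrite /v /lat colE -mulmxA -colE; congr (_ *m _).
  by apply/colP => i; rewrite !mxE.
have gZ i j : (g *m map_mx intr Z) i j = v (mu j) i 0.
  by have /colP/(_ i) := colZ j; rewrite [LHS]mxE.
exists a, Z; split=> // [|i j|z z0].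
(* A kernel vector of [Z] gives, up to signs, a relation among the elements of [J], which
   [feasible_free] excludes. *)
- apply/negP => /eqP Z0.
  have : \det (map_mx intr Z^T : 'M[R]_n.+1) == 0.
    by rewrite det_map_mx det_tr Z0 rmorph0.
  case/det0P => y /rV0Pn[j0 yj0] yZ.
  pose Y (e : E) := if e is inr m then
    \sum_(j | mu j == m) y 0 j * Num.sg (ell (v m)) else 0.
  have Ymu j : Y (inr (mu j)) = y 0 j * Num.sg (ell (v (mu j))).
    by rewrite /Y (big_pred1 j) // => i; rewrite (inj_eq mu_inj).
  have sgv m : Num.sg (ell (v m)) != 0.
    by rewrite sgr_eq0 -normr_gt0 (lt_le_trans _ (ell_v m)) ?divr_gt0 ?mulr_gt0.
  have /(_ (inr (mu j0))) : forall e, Y e = 0.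
    apply: (feasible_free b_gen cJ x0 xb) => [[k|m]|] //=.
      move=> mJ; rewrite big_pred0 // => j; apply: contraNF mJ => /eqP <-.
      exact: muJ'.
    rewrite (bigID (mem J)) /= [X in _ + X]big1 ?addr0; last first.
      move=> [k|m] mJ /=; rewrite ?scale0r // big_pred0 ?scale0r // => j.
      by apply: contraNF mJ => /eqP <-; exact: muJ'.
    rewrite muJ big_imset /=; last by move=> i j _ _ [] /mu_inj.
    transitivity ((g *m map_mx intr Z) *m y^T).
      apply/colP => i; rewrite summxE [RHS]mxE; apply: eq_big => // j _.
      rewrite gZ (big_pred1 j) => [|k]; last by rewrite (inj_eq mu_inj).
      rewrite scalerA -mulrA -expr2 sqr_sg -sgr_eq0 sgv mulr1.
      by rewrite [LHS]mxE [y^T _ _]mxE mulrC.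
    rewrite -mulmxA (_ : _ *m y^T = 0) ?mulmx0 //.
    by apply: trmx_inj; rewrite trmx_mul trmxK map_trmx yZ trmx0.
  by move/eqP; rewrite Ymu mulf_eq0 (negPf yj0) (negPf (sgv _)).
- by rewrite gZ va.
(* A vector strictly inside the box shrunk by [q] would have a net representative strictly inside
   the box itself, against [dom]. *)
- apply: contrapT => /forallNP hz.
  have {}hz i : q * `|lat z i 0| < a i by rewrite ltNge; apply/negP/hz.
  have [|m hm] := net z z0.
    move=> k; apply: ltW; apply: le_lt_trans (_ : q * `|lat z k 0| <  T) => //.
    + by rewrite ler_peMl // ltW.
    + apply: lt_le_trans (hz k) _; apply/bigmax_leP; split=> // m _; exact: zzT.
  have [k _ hk] := dom m.
  have : a k <= `|v m k 0|.
    by apply/bigmax_leP; split.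
  apply/negP; rewrite -ltNge; apply: le_lt_trans (hm k) _.
  rewrite maxr_pMr ?ltW // gt_max hz /=; exact: lt_le_trans qt (a_eta k).
Qed.

End Box.

(** Here [t] is of order [1 / N] with [N] polynomial in [L], while [T = t * q ^+ L] grows
    exponentially; so some [L] makes [T * t ^+ n] exceed the constant [C] that the thin vectors
    require. *)
Lemma almost_admissible_box (R : realType) (n : nat) (g : 'M[R]_n) (q : R) :
  (1 < n)%N -> \det g = 1 -> 1 < q ->
  exists (a : 'I_n -> R) (Z : 'M[int]_n),
  [/\ forall i, 0 < a i, \det Z != 0,
      forall i j, `|(g *m map_mx intr Z) i j| <= a i &
      forall z : 'cV[int]_n, z != 0 ->
        exists i, a i <= q * `|(g *m map_mx intr z) i 0| ].
Proof.
case: n g => // n g n_gt0 g1 q_gt1.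
have q_gt0 : 0 < q by apply: lt_trans q_gt1.
have [r /andP[r_gt0 r_le1] sep] := lattice_separation g1.
have [A A_ge1 thin] := thin_lattice_vector g.
have A_gt0 : 0 < A by apply: lt_le_trans A_ge1.
(* [D] collects the constants of [etaE], which then holds for [t = r / (D * N)]. *)
pose D : R := 2 * q * (n.+1%:R * 2 ^+ n.+2 * 6).
have D_ge1 : 1 <= D.
  have h1 : (1 : R) <= n.+1%:R by rewrite ler1n.
  have h2 : (1 : R) <= 2 ^+ n.+2 by rewrite exprn_ege1 // ler1n.
  have h3 : 1 <= n.+1%:R * 2 ^+ n.+2 :> R by rewrite mulr_ege1.
  have h6 : (1 : R) <= 6 by rewrite ler1n.
  have h7 : (1 : R) <= 2 by rewrite ler1n.
  by apply: mulr_ege1; apply: mulr_ege1 => //; apply: ltW.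
have D_gt0 : 0 < D by apply: lt_le_trans D_ge1.
pose k := r / D.
have k_gt0 : 0 < k by rewrite divr_gt0.
have k_le1 : k <= 1 by rewrite ler_pdivrMr // mul1r (le_trans r_le1).
pose C := 2 * A * (3 * A) ^+ n + 2 * A.
have [L hL] := exp_dominates_poly (C / k ^+ n.+1) (n.+1 * n.+1)%N q_gt1.
pose N : R := #|{ffun 'I_n.+1 -> 'I_L.+1}|%:R.
have NE : N = L.+1%:R ^+ n.+1 by rewrite /N card_ffun !card_ord natrX.
have N_ge1 : 1 <= N by rewrite NE exprn_ege1 // ler1n.
have N_gt0 : 0 < N by apply: lt_le_trans N_ge1.
pose t := k / N.
have t_gt0 : 0 < t by rewrite divr_gt0.
have t_le1 : t <= 1 by rewrite ler_pdivrMr // mul1r (le_trans k_le1).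
pose T := t * q ^+ L.
have qL_gt0 : 0 < q ^+ L by rewrite exprn_gt0.
have T_gt0 : 0 < T by rewrite mulr_gt0.
have hTt : C <= T * t ^+ n.
  rewrite /T mulrAC -exprS /t expr_div_n.
  move: hL; rewrite exprM -NE mulrAC ler_pdivrMr ?exprn_gt0 //.
  by rewrite mulrAC ler_pdivlMr ?exprn_gt0 // [k ^+ _ * _]mulrC.
have hC : 2 * A <= C.
  by rewrite /C lerDr !mulr_ge0 ?exprn_ge0 ?mulr_ge0 ?(ltW A_gt0).
have hT : 2 * A <= T.
  apply: le_trans hC _; apply: le_trans hTt _.
  by rewrite ler_piMr ?exprn_ile1 ?(ltW t_gt0) ?(ltW T_gt0).
pose Q := Num.truncn (T / A).
have /andP[QT TQ] := truncn_itv (ltW (divr_gt0 T_gt0 A_gt0)).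
rewrite -/Q ler_pdivlMr // mulrC in QT.
rewrite -/Q ltr_pdivrMr // -natr1 mulrDl mul1r [_ * A]mulrC in TQ.
apply: (@box_of_scales _ _ g q _ _ r t L) => //.
- rewrite -/N /t /k /D; field; rewrite nat1r.
  by rewrite !lt0r_neq0 ?exprn_gt0.
- move=> i0; have [||z [z0 zi zk]] := thin Q t i0.
  + rewrite t_gt0 /=; lra.
  + have hQ : T / (2 * A) <= Q%:R.
      rewrite ler_pdivrMr ?mulr_gt0 //; move: TQ; rewrite mulrA; lra.
    apply: le_trans (ler_wpM2r (exprn_ge0 _ (ltW t_gt0)) hQ).
    rewrite mulrAC ler_pdivlMr ?mulr_gt0 //; apply: le_trans hTt.
    by rewrite /C mulrC lerDl mulr_ge0 ?(ltW A_gt0).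
  + by exists z; split=> //; apply: le_trans QT.
- by rewrite -/T (le_trans t_le1) //; lra.
Qed.

(** * Hadamard's inequality and the uniform bound *)

(** Gram-Schmidt by induction: replacing the first row by its component [u] orthogonal to the others
    keeps the determinant, which becomes [|u|^2] times the smaller one, and does not lengthen the
    row. If the smaller one vanishes, the rows are dependent. *)
Lemma gram_det_bounds (R : realFieldType) (m n : nat) (A : 'M[R]_(m, n)) :
  0 <= \det (A *m A^T) <= \prod_i \sum_j A i j ^+ 2.
Proof.
elim: m A => [|m IH] A; first by rewrite det_mx00 big_ord0 ler01 lexx.
pose r : 'rV[R]_n := usubmx (A : 'M[R]_(1 + m, n)).
pose A' : 'M[R]_(m, n) := dsubmx (A : 'M[R]_(1 + m, n)).
have AE : A = col_mx r A' by rewrite vsubmxK.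
have r2 : (r *m r^T) 0 0 = \sum_j A ord0 j ^+ 2.
  rewrite mxE; apply: eq_bigr => j _; rewrite !mxE -expr2.
  by congr (A _ _ ^+ 2); apply: val_inj.
have prodE : \prod_i \sum_j A i j ^+ 2 =
    (r *m r^T) 0 0 * \prod_i \sum_j A' i j ^+ 2.
  rewrite big_ord_recl r2; congr (_ * _); apply: eq_bigr => i _.
  apply: eq_bigr => j _; rewrite mxE; congr (A _ _ ^+ 2); exact: val_inj.
have /andP[d_ge0 d_le] := IH A'.
have sq_ge0 (u : 'rV[R]_n) : 0 <= (u *m u^T) 0 0.
  by rewrite mxE sumr_ge0 // => j _; rewrite mxE -expr2 sqr_ge0.
rewrite prodE; set G := A' *m A'^T in d_ge0 d_le *.
have [G0|G0] := eqVneq (\det G) 0.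
  have -> : \det (A *m A^T) = 0.
    have /eqP/det0P[v v0 vG] := G0.
    have vA : v *m A' = 0.
      have : (v *m A' *m (v *m A')^T) 0 0 = 0.
        by rewrite trmx_mul !mulmxA -[v *m A' *m _]mulmxA vG mul0mx mxE.
      rewrite mxE => /psumr_eq0P h; apply/rowP => j; rewrite [RHS]mxE.
      apply/eqP; rewrite -sqrf_eq0 expr2.
      have : forall i, true -> 0 <= (v *m A') 0 i * (v *m A')^T i 0.
        by move=> i _; rewrite [X in _ * X]mxE -expr2 sqr_ge0.
      by move/h => /(_ j isT); rewrite [X in _ * X]mxE => ->.
    apply/eqP/det0P; exists (row_mx 0 v : 'rV_(1 + m)).
      apply/eqP => /rowP e; case/eqP: v0; apply/rowP => j.
      by rewrite -(row_mxEr (0 : 'M[R]_1) v 0 j); apply: etrans (e _) _; rewrite !mxE.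
    have vA0 : row_mx (0 : 'M[R]_1) v *m col_mx r A' = 0.
      by rewrite mul_row_col mul0mx vA addr0.
    by rewrite mulmxA [X in X *m _](_ : _ = 0) ?mul0mx // AE; exact: vA0.
  rewrite lexx mulr_ge0 // (le_trans d_ge0 d_le) //.
have GU : G \in unitmx by rewrite unitmxE unitfE.
pose c := r *m A'^T *m invmx G.
pose u := r - c *m A'.
have uA : u *m A'^T = 0.
  by rewrite mulmxBl -[c *m A' *m _]mulmxA -/G mulmxKV // subrr.
have detE : \det (A *m A^T) = (u *m u^T) 0 0 * \det G.
  pose P : 'M[R]_(1 + m) := block_mx 1%:M (- c) 0 1%:M.
  have PA : P *m A = col_mx u A'.
    by rewrite AE mul_block_col !mul1mx mul0mx add0r mulNmx.
  have P1 : \det P = 1 by rewrite det_ublock !det1 mulr1.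
  have -> : \det (A *m A^T) = \det ((P *m A) *m (P *m A)^T).
    rewrite trmx_mul !mulmxA -[P *m A *m A^T]mulmxA.
    by rewrite !det_mulmx det_tr P1 mulr1 mul1r.
  rewrite PA tr_col_mx mul_col_row uA -/G.
  by rewrite det_lblock det_mx11.
have uu : (u *m u^T) 0 0 <= (r *m r^T) 0 0.
  have uw : u *m (c *m A')^T = 0 by rewrite trmx_mul mulmxA uA mul0mx.
  have wu : c *m A' *m u^T = 0 by apply: trmx_inj; rewrite trmx_mul trmxK uw trmx0.
  have -> : r *m r^T = u *m u^T + c *m A' *m (c *m A')^T.
    have -> : r = u + c *m A' by rewrite subrK.
    move: u (c *m A') uw wu {uA detE} => u w uw wu.
    by rewrite linearD /= mulmxDl !mulmxDr uw wu addr0 add0r.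
  by rewrite [leRHS]mxE lerDl sq_ge0.
by rewrite detE mulr_ge0 // ler_pM.
Qed.

Lemma hadamard_sq (R : realFieldType) (n : nat) (A : 'M[R]_n) :
  \det A ^+ 2 <= \prod_i \sum_j A i j ^+ 2.
Proof.
by have /andP[_] := gram_det_bounds A; rewrite det_mulmx det_tr -expr2.
Qed.

Lemma bernoulli_sub (R : realDomainType) (x : R) (m : nat) : 0 <= x <= 1 ->
  1 - m%:R * x <= (1 - x) ^+ m.
Proof.
move=> /andP[x0 x1]; elim: m => [|m IH]; first by rewrite mul0r subr0.
rewrite exprS; apply: (@le_trans _ _ ((1 - x) * (1 - m%:R * x))); last first.
  by rewrite ler_wpM2l ?subr_ge0.
rewrite -subr_ge0 -natr1.
have -> : (1 - x) * (1 - m%:R * x) - (1 - (m%:R + 1) * x) = m%:R * x ^+ 2 by ring.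
by rewrite mulr_ge0 ?sqr_ge0.
Qed.

Lemma sum_ord_le (R : numDomainType) (n : nat) (F : 'I_n -> R) (c : R) :
  (forall i, F i <= c) -> \sum_i F i <= n%:R * c.
Proof.
move=> Fc; apply: le_trans (ler_sum _ (fun i _ => Fc i)) _.
by rewrite sumr_const card_ord mulr_natl.
Qed.

Lemma norm_det_le_fact (R : realDomainType) (n : nat) (M : 'M[R]_n) :
  (forall i j, `|M i j| <= 1) -> `|\det M| <= n`!%:R.
Proof.
move=> M1; apply: le_trans (ler_norm_sum _ _ _) _.
have <- : \sum_(s : 'S_n) 1 = n`!%:R :> R.
  by rewrite sumr_const -card_Sn; congr (_ *+ _); apply: eq_card.
apply: ler_sum => s _; rewrite normrM normrX normrN1 expr1n mul1r normr_prod.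
by apply: prodr_ile1 => i; rewrite normr_ge0 M1.
Qed.

(** Cramer's rule: [\adj W] sends [W *m y] to [\det W *: y], and cofactors are at most [n!] in
    absolute value. *)
Lemma norm_solution_le (R : realFieldType) (n : nat) (W : 'M[R]_n)
    (y : 'cV[R]_n) (d : R) :
  (forall i j, `|W i j| <= 1) -> 1 <= `|\det W| ->
  (forall i, `|(W *m y) i 0| <= d) -> forall j, `|y j 0| <= n%:R * n`!%:R * d.
Proof.
move=> W1 dW Wy j; apply: (@le_trans _ _ (`|\det W| * `|y j 0|)).
  by rewrite ler_peMl.
have -> : `|\det W| * `|y j 0| = `|(\adj W *m (W *m y)) j 0|.
  by rewrite mulmxA mul_adj_mx mul_scalar_mx mxE normrM.
rewrite mxE (le_trans (ler_norm_sum _ _ _)) //.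
rewrite -mulrA; apply: sum_ord_le => i.
rewrite normrM; apply: ler_pM => //.
rewrite mxE /cofactor normrM normrX normrN1 expr1n mul1r.
apply: le_trans (norm_det_le_fact _) _ => [k l|]; first by rewrite !mxE.
by rewrite ler_nat; case: (n) {W y W1 dW Wy i j} => // m; rewrite leq_pmull.
Qed.

Lemma int_norm_lt1 (x : int) : `|x| < 1 -> x = 0.
Proof. by case: x => [[|k]|k]. Qed.

(* If [W] is close to a sign matrix [H], then the coordinates of [H *m y] are
   integers of the same parity. *)
Lemma near_sign_matrix (R : realFieldType) (n : nat) (W : 'M[R]_n) (e e' : R)
    (y : 'cV[int]_n) (i0 : 'I_n) : (1 < n)%N ->
  (forall i j, 1 - e <= `|W i j| <= 1) -> 1 <= `|\det W| ->
  0 <= e -> e' <= 1 / 4 ->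
  e * (4 * (n%:R * n`!%:R) * (n%:R * n`!%:R) * n%:R) <= e' ->
  `|(W *m map_mx intr y) i0 0| < 3 / 2 ->
  (forall k, k != i0 -> `|(W *m map_mx intr y) k 0| < 1 - e') ->
  y = 0.
Proof.
move=> n_gt1 W_bd dW e_ge0 e'_le he u0 uk.
have n1 : (1 : R) <= n%:R by rewrite ler1n ltnW.
set F := n%:R * n`!%:R in he.
have F1 : 1 <= F by rewrite mulr_ege1 // ler1n fact_gt0.
have W1 i j : `|W i j| <= 1 by case/andP: (W_bd i j).
pose yR : 'cV[R]_n := map_mx intr y.
pose u := W *m yR.
have e'_ge0 : 0 <= e'.
  by apply: le_trans he; rewrite !mulr_ge0 // (le_trans ler01).
have y_le j : `|yR j 0| <= F * (3 / 2).
  apply: (norm_solution_le W1 dW) => i.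
  have [->|/uk ui] := eqVneq i i0; first exact: ltW.
  by apply: ltW; apply: lt_le_trans ui _; lra.
pose H : 'M[int]_n := \matrix_(i, j) (if 0 <= W i j then 1 else -1).
pose E : 'M[R]_n := W - map_mx intr H.
have E_le i j : `|E i j| <= e.
  rewrite !mxE; have := W_bd i j; have [w|w] := leP 0 (W i j).
    by rewrite ger0_norm // ler_norml => /andP[w1 w2]; lra.
  by rewrite ltr0_norm // ler_norml mulrNz opprK => /andP[w1 w2]; lra.
have Ey_le i : `|(E *m yR) i 0| * F <= e' / 2.
  apply: (@le_trans _ _ (n%:R * (e * (F * (3 / 2))) * F)); last first.
    move: he; lra.
  rewrite ler_wpM2r ?(le_trans ler01) // mxE (le_trans (ler_norm_sum _ _ _)) //.
  apply: sum_ord_le => j.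
  by rewrite normrM ler_pM.
have Ey_le' i : `|(E *m yR) i 0| <= e' / 2.
  by apply: le_trans (Ey_le i); rewrite ler_peMr.
have HyE i : ((H *m y) i 0)%:~R = u i 0 - (E *m yR) i 0 :> R.
  have WE : W = E + map_mx intr H by rewrite subrK.
  rewrite /u [in X in X - _]WE mulmxDl [X in X - _]mxE addrAC subrr add0r.
  by rewrite -map_mxM [RHS]mxE.
have Hy_lt i (c : R) : `|u i 0| < c -> `|(H *m y) i 0|%:~R < c + e' / 2.
  move=> uc; rewrite intr_norm HyE (le_lt_trans (ler_normB _ _)) //.
  by rewrite ltr_leD.
have Hyk k : k != i0 -> (H *m y) k 0 = 0.
  move=> /uk /Hy_lt h; have : `|(H *m y) k 0|%:~R < 1 :> R.
    by apply: lt_le_trans h _; move: e'_ge0; lra.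
  by rewrite -[1]/(1%:~R) ltr_int => /int_norm_lt1.
have parity i j : exists m : int, (H *m y) i 0 - (H *m y) j 0 = 2 * m.
  rewrite !mxE -sumrB.
  pose h i k : int := if (0 <= W i k)%R then 1 else 0.
  exists (\sum_k (h i k - h j k) * y k 0).
  rewrite mulr_sumr; apply: eq_bigr => k _; rewrite !mxE.
  by rewrite /h; case: (0 <= W i k); case: (0 <= W j k); ring.
have [k ki0] : exists k : 'I_n, k != i0.
  have : (1 < #|'I_n|)%N by rewrite card_ord.
  by rewrite (cardD1 i0) inE add1n ltnS => /card_gt0P[k]; rewrite !inE andbT; exists k.
(* The coordinate at [i0] has the parity of the vanishing ones and is less than 2 in absolute
   value. *)
have Hy0 : H *m y = 0.
  apply/colP => i; rewrite [RHS]mxE; have [->|/Hyk//] := eqVneq i i0.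
  have [m] := parity i0 k; rewrite (Hyk k) // subr0 => Hm.
  have : `|(H *m y) i0 0|%:~R < 2%:~R :> R.
    by apply: lt_le_trans (Hy_lt _ _ u0) _; rewrite (_ : 2%:~R = 2) //; lra.
  rewrite ltr_int Hm normrM [`|2|]ger0_norm // -[ltRHS]mulr1 ltr_pM2l //.
  by move=> /int_norm_lt1 ->; rewrite mulr0.
(* Now [W *m yR] is only the error [E *m yR], small enough to force the integers [y j] to vanish. *)
have Wy i : `|(W *m yR) i 0| <= e' / 2 / F.
  rewrite ler_pdivlMr ?(lt_le_trans ltr01) //; apply: le_trans (Ey_le i).
  have := HyE i; rewrite Hy0 mxE => /eqP; rewrite eq_sym subr_eq0 => /eqP <-.
  by rewrite lexx.
apply/colP => j; have := norm_solution_le W1 dW Wy j.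
rewrite -/F mulrC divfK ?gt_eqF ?(lt_le_trans ltr01) // => hy.
have : `|y j 0|%:~R < 1%:~R :> R.
  by rewrite intr_norm; move: hy; rewrite mxE => /le_lt_trans; apply; lra.
by rewrite ltr_int [RHS]mxE => /int_norm_lt1.
Qed.

(** For the normalised matrix [W], [P ^+ 2 * \det W ^+ 2 = (\det Z) ^+ 2]. Room comes from an index
    of at least 2, from an entry below [1 - e] that improves Hadamard's bound, from [|\det W| < 1],
    or else from [near_sign_matrix]. *)
Lemma uniform_admissible_box (R : realType) (n : nat) : (1 < n)%N ->
  exists2 theta : R, 1 < theta & forall g : 'M[R]_n, \det g = 1 ->
    exists a : 'I_n -> R, [/\ forall i, 0 <= a i,
      forall z : 'cV[int]_n, z != 0 ->
        exists i, a i <= `|(g *m map_mx intr z) i 0| &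
      theta <= (\prod_i a i) ^+ 2 * n%:R ^+ n].
Proof.
move=> n_gt1; have n_gt0 : 0 < n%:R :> R by rewrite ltr0n ltnW.
have n_ge1 : 1 <= n%:R :> R by rewrite ler1n ltnW.
pose F : R := n%:R * n`!%:R.
have F_ge1 : 1 <= F by rewrite mulr_ege1 // ler1n fact_gt0.
pose D := 4 * F * F * n%:R.
have D_ge1 : 1 <= D.
  have h4 : (1 : R) <= 4 by rewrite ler1n.
  by do 3!apply: mulr_ege1 => //.
have D_gt0 : 0 < D by apply: lt_le_trans D_ge1.
(* Shrinking sides by [1 - e'] costs at most a quarter of the squared volume. *)
pose e' : R := (8 * n%:R)^-1.
have e'_gt0 : 0 < e' by rewrite invr_gt0 mulr_gt0.
have ne' : n%:R * e' = 1 / 8 by rewrite /e'; field; rewrite gt_eqF.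
have e'_le : e' <= 1 / 8 by rewrite -ne' ler_peMl // ltW.
(* This gives equality in the smallness condition of [near_sign_matrix]. *)
pose e := e' / D.
have e_gt0 : 0 < e by rewrite divr_gt0.
have e_le : e <= e' by rewrite ler_pdivrMr // ler_peMr // ltW.
pose rho := e / n%:R.
have rho_gt0 : 0 < rho by rewrite divr_gt0.
have rho_le : rho <= 1 / 8.
  by rewrite ler_pdivrMr // (le_trans e_le) // (le_trans e'_le) // ler_peMr // divr_ge0.
(* With [q = p^-1], shrinking all sides by [p] makes the box admissible and loses at most a fraction
   [rho / 4] of the squared volume. *)
pose p := 1 - rho * e'.
have re_ge0 : 0 < rho * e' by rewrite mulr_gt0.
have re_le1 : rho * e' <= 1 / 8.
  rewrite (le_trans _ rho_le) // ler_piMr // ?(ltW rho_gt0) //.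
  by move: e'_le; lra.
have p_gt0 : 0 < p by rewrite /p; lra.
have pn : 1 - rho / 4 <= (p ^+ n) ^+ 2.
  rewrite -exprM; apply: le_trans (bernoulli_sub _ _); last by apply/andP; split; lra.
  have -> : (n * 2)%:R * (rho * e') = 2 * rho * (n%:R * e') by rewrite natrM; ring.
  by rewrite ne'; lra.
exists (1 + rho / 2) => [|g g1]; first by lra.
have q_gt1 : 1 < p^-1 by rewrite invf_gt1 // /p; lra.
have [a [Z [a_gt0 Z0 gZ adm]]] := almost_admissible_box n_gt1 g1 q_gt1.
set P := \prod_i a i.
have P_gt0 : 0 < P by apply: prodr_gt0.
have shrink c : c <= P ^+ 2 * n%:R ^+ n -> 1 + rho / 2 <= c * (1 - rho / 4) ->
    exists a : 'I_n -> R, [/\ forall i, 0 <= a i,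
      forall z : 'cV[int]_n, z != 0 ->
        exists i, a i <= `|(g *m map_mx intr z) i 0| &
      1 + rho / 2 <= (\prod_i a i) ^+ 2 * n%:R ^+ n].
  move=> cP hc; exists (fun i => p * a i); split=> [i|z /adm[i hi]|].
  - by rewrite mulr_ge0 // ltW.
  - by exists i; rewrite -ler_pdivlMl.
  - rewrite big_split /= prodr_const card_ord -/P.
    have -> : (p ^+ n * P) ^+ 2 * n%:R ^+ n = P ^+ 2 * n%:R ^+ n * (p ^+ n) ^+ 2 by ring.
    apply: le_trans hc _; apply: (@le_trans _ _ (P ^+ 2 * n%:R ^+ n * (1 - rho / 4))).
      by rewrite ler_wpM2r //; lra.
    by rewrite ler_wpM2l // mulr_ge0 ?exprn_ge0 // ltW.
pose W := \matrix_(i, j) ((g *m map_mx intr Z) i j / a i).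
have W1 i j : `|W i j| <= 1.
  by rewrite mxE normrM [`|_^-1|]gtr0_norm ?invr_gt0 // ler_pdivrMr // mul1r gZ.
have Wy (y : 'cV[int]_n) i :
    (W *m map_mx intr y) i 0 = (g *m map_mx intr (Z *m y)) i 0 / a i.
  rewrite map_mxM mulmxA [in RHS]mxE [LHS]mxE mulr_suml.
  by apply: eq_bigr => j _; rewrite mxE mulrAC.
have detW : \det W * P = (\det Z)%:~R.
  have -> : W = diag_mx (\row_i (a i)^-1) *m (g *m map_mx intr Z).
    by apply/matrixP => i j; rewrite mul_diag_mx !mxE mulrC.
  rewrite !det_mulmx g1 mul1r det_diag det_map_mx mulrAC -big_split /=.
  by rewrite big1 ?mul1r // => i _; rewrite mxE mulVf // gt_eqF.
have had := hadamard_sq W.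
have sqn (x : R) : `|x| ^+ 2 = x ^+ 2 by rewrite real_normK ?num_real.
have W2 i j : W i j ^+ 2 <= 1.
  by rewrite -sqn exprn_ile1.
have row_le i : \sum_j W i j ^+ 2 <= n%:R.
  by rewrite -[leRHS]mulr1 sum_ord_le.
have row_ge0 i : 0 <= \sum_j W i j ^+ 2 by rewrite sumr_ge0 // => j _; apply: sqr_ge0.
have hadn : \det W ^+ 2 <= n%:R ^+ n.
  apply: le_trans had _.
  have <- : \prod_(i < n) n%:R = n%:R ^+ n :> R by rewrite prodr_const card_ord.
  by apply: ler_prod => i _; rewrite row_ge0 row_le.
have detW2 : P ^+ 2 * \det W ^+ 2 = (\det Z)%:~R ^+ 2 by rewrite -detW exprMn mulrC.
have P2_gt0 : 0 < P ^+ 2 by rewrite exprn_gt0.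
have [Z2|Z2] := leP 2 `|\det Z|.
  apply: (shrink 4); last by move: rho_le rho_gt0; lra.
  apply: (le_trans (y := P ^+ 2 * \det W ^+ 2)); last by rewrite ler_pM2l.
  rewrite detW2 -sqn -intr_norm (_ : 4 = 2%:~R ^+ 2) ?lerXn2r ?nnegrE ?ler_int //.
  by rewrite -[RHS]/(2 ^+ 2) -natrX.
have Z1 : `|\det Z| = 1.
  by move: Z0 Z2; rewrite -normr_gt0; case: `|\det Z| => [[|[|k]]|k].
have detZ2 : P ^+ 2 * \det W ^+ 2 = 1.
  by rewrite detW2 -sqn -intr_norm Z1 expr1n.
have ge1 c : \det W ^+ 2 <= c -> 1 <= P ^+ 2 * c.
  by move=> Wc; rewrite -(ler_pM2l P2_gt0) detZ2 in Wc.
have [/existsP[i /existsP[j Wij]]|] := boolP [exists i, exists j, `|W i j| < 1 - e].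
  apply: (shrink (1 - rho)^-1); last first.
    rewrite ler_pdivlMl; last by move: rho_le; lra.
    rewrite -subr_ge0; have -> : 1 - rho / 4 - (1 - rho) * (1 + rho / 2) =
      rho / 4 + rho ^+ 2 / 2 by field.
    by rewrite addr_ge0 ?divr_ge0 ?sqr_ge0 // ltW.
  have rho_lt1 : 0 < 1 - rho by move: rho_le; lra.
  rewrite -[leLHS]div1r ler_pdivrMr // -mulrA; apply: ge1.
  have Wij2 : W i j ^+ 2 <= 1 - e.
    by rewrite -sqn (le_trans _ (ltW Wij)) // expr2 ler_piMr.
  (* The small entry loses [e = n * rho] from the row sum. *)
  have row_i : \sum_k W i k ^+ 2 <= n%:R * (1 - rho).
    apply: (@le_trans _ _ (\sum_k (1 - (if k == j then e else 0)))).
      by apply: ler_sum => k _; case: eqVneq => [->//|_]; rewrite subr0.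
    rewrite sumrB sumr_const card_ord -big_mkcond big_pred1_eq mulrBr mulr1.
    by rewrite mulrC divfK // gt_eqF.
  apply: le_trans had _; rewrite mulrC.
  have -> : (1 - rho) * n%:R ^+ n =
      \prod_(k < n) ((if k == i then 1 - rho else 1) * n%:R).
    rewrite big_split /= prodr_const card_ord; congr (_ * _).
    by rewrite -big_mkcond big_pred1_eq.
  apply: ler_prod => k _; rewrite row_ge0 /=.
  by case: eqVneq => [->|_]; rewrite ?mul1r // mulrC.
move=> /existsPn hW.
have W_bd i j : 1 - e <= `|W i j| <= 1.
  by rewrite W1 andbT leNgt; have /existsPn := hW i; apply.
have [dW|dW] := leP 1 `|\det W|; last first.
  apply: (shrink 4); last by move: rho_le rho_gt0; lra.
  have detW1 : \det W ^+ 2 <= 1 by rewrite -sqn exprn_ile1 // ltW.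
  apply: (@le_trans _ _ (1 * n%:R ^+ n)).
    rewrite mul1r -natrX ler_nat (@leq_trans (2 ^ n)) //.
      by rewrite (leq_pexp2l (isT : 0 < 2)%N n_gt1).
    by rewrite leq_exp2r // ltnW.
  by rewrite ler_wpM2r ?exprn_ge0 // -[P ^+ 2]mulr1 ge1.
have i0 : 'I_n by exact: Ordinal (ltnW n_gt1).
(* Half as long again along an arbitrary [i0], slightly shorter elsewhere: the squared volume grows
   by at least [9 / 4 * (3 / 4) > 1]. *)
exists (fun i => (if i == i0 then 3 / 2 else 1 - e') * a i); split=> [i|z z0|].
- by rewrite mulr_ge0 ?(ltW (a_gt0 i)) //; case: ifP => _; move: e'_le; lra.
- apply: contrapT => /forallNP hz.
  have ZU : Z \in unitmx.
    have : (\det Z == 1) || (\det Z == -1) by rewrite -[_ || _]andbT -eqr_norml Z1.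
    by rewrite unitmxE => /orP[]/eqP->; rewrite ?unitrN1 ?unitr1.
  case/eqP: z0; rewrite -(mulKVmx ZU z).
  rewrite (@near_sign_matrix _ _ W e e' (invmx Z *m z) i0) ?mulmx0 //.
  + exact: ltW.
  + by move: e'_le; lra.
  + by rewrite -/F -/D divfK // gt_eqF.
  + have /negP := hz i0; rewrite eqxx -ltNge.
    by rewrite Wy mulKVmx // normrM [`|_^-1|]gtr0_norm ?invr_gt0 // ltr_pdivrMr.
  + move=> k ki0; have /negP := hz k; rewrite (negPf ki0) -ltNge.
    by rewrite Wy mulKVmx // normrM [`|_^-1|]gtr0_norm ?invr_gt0 // ltr_pdivrMr.
- rewrite big_split /= -/P; set c := \prod_i _.
  have P1 : 1 <= P ^+ 2 * n%:R ^+ n by exact: ge1.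
  have e'2 : 0 <= e' <= 1 by rewrite ltW //=; move: e'_le; lra.
  have e'n : 3 / 4 <= ((1 - e') ^+ n) ^+ 2.
    rewrite -exprM; apply: le_trans (bernoulli_sub _ e'2).
    by rewrite natrM mulrAC ne'; lra.
  have e'0 : 0 <= 1 - e' by rewrite subr_ge0; case/andP: e'2.
  have c_ge : 3 / 2 * (1 - e') ^+ n <= c.
    rewrite /c (bigD1 i0) //= eqxx ler_wpM2l ?divr_ge0 //.
    under eq_bigr => i ii0 do rewrite (negPf ii0).
    have -> : (1 - e') ^+ n = \prod_(i < n) (1 - e') by rewrite prodr_const card_ord.
    rewrite (bigD1 i0) //= ler_piMl ?prodr_ge0 //.
    by rewrite lerBlDr lerDl ltW.
  have c2 : 9 / 4 * (3 / 4) <= c ^+ 2.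
    apply: (@le_trans _ _ ((3 / 2 * (1 - e') ^+ n) ^+ 2)).
      by rewrite exprMn; move: e'n; lra.
    by rewrite lerXn2r // nnegrE ?(le_trans _ c_ge) // mulr_ge0 ?exprn_ge0 ?divr_ge0.
  have -> : (c * P) ^+ 2 * n%:R ^+ n = c ^+ 2 * (P ^+ 2 * n%:R ^+ n) by ring.
  apply: (@le_trans _ _ (c ^+ 2 * 1)); last by rewrite ler_wpM2l ?sqr_ge0.
  by rewrite mulr1; apply: le_trans c2; move: rho_le; lra.
Qed.

(** * The Mordell constant *)

Lemma interior_symmetric_box (R : realType) (n : nat) (a : 'I_n -> R)
    (v : 'cV[R]_n) : interior (symmetric_box a) v -> forall i, `|v i ord0| < a i.
Proof.
rewrite /interior /= => /nbhs_ballP[r /= r_gt0 rv] i.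
(* Every coordinate is pushed away from 0 by [r / 2], which stays in the ball. *)
pose d := (r / 2) *: const_mx (if 0 <= v i ord0 then 1 else -1) : 'cV[R]_n.
have : symmetric_box a (v + d).
  apply: rv; split=> // k j /=.
  rewrite /ball /= !mxE opprD addrA subrr add0r normrN normrM gtr0_norm ?divr_gt0 //.
  by case: ifP; rewrite ?normrN normr1 mulr1; lra.
move=> /(_ i); rewrite !mxE; have r2 : 0 < r / 2 by rewrite divr_gt0.
have [w|w] := leP 0 (v i ord0) => /andP[h1 h2].
  by rewrite ger0_norm //; lra.
by rewrite ltr0_norm //; lra.
Qed.

Lemma admissible_symmetric_box (R : realType) (n : nat) (g : 'M[R]_n)
    (a : 'I_n -> R) :
  (forall z : 'cV[int]_n, z != 0 ->
     exists i, a i <= `|(g *m map_mx intr z) i 0|) ->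
  admissible (lattice_of g) (symmetric_box a).
Proof.
move=> adm _ [z _ <-] /interior_symmetric_box vB.
have [->|/adm[i]] := eqVneq z 0; first by rewrite map_mx0 mulmx0.
by rewrite leNgt vB.
Qed.

Lemma mordell_constant_ge (R : realType) (n : nat) (x : set 'cV[R]_n)
    (a : 'I_n -> R) : (forall i, 0 <= a i) -> admissible x (symmetric_box a) ->
  ((\prod_i a i)%:E <= mordell_constant x)%E.
Proof.
move=> a_ge0 adm; rewrite /mordell_constant.
have -> : (\prod_i a i)%:E = (((2 ^+ n)^-1)%:E * (box_volume a)%:E)%E.
  rewrite -EFinM /box_volume big_split /= prodr_const card_ord mulKf //.
apply: lee_wpmul2l; first by rewrite lee_fin invr_ge0 exprn_ge0.
by apply: ereal_sup_ubound; exists a.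
Qed.

Theorem proposition4p2 (R : realType) (n : nat) (hn : (2 <= n)%N) :
  ((n%:R `^ (- (n%:R / 2)))%:E < kappa_inf R n)%E.
Proof.
have [theta theta_gt1 box] := uniform_admissible_box R hn.
have n_gt0 : 0 < n%:R :> R by rewrite ltr0n ltnW.
set c := _ `^ _; have c_gt0 : 0 < c by apply: powR_gt0.
have c2 : c ^+ 2 * n%:R ^+ n = 1.
  rewrite -!powR_mulrn ?ltW // -powRrM -powRD; last by rewrite (gt_eqF n_gt0) implybT.
  by rewrite mulNr divfK ?pnatr_eq0 // addNr powRr0.
(* As [theta] does not depend on the lattice, all Mordell constants are at least [c * s], so the
   infimum stays strictly above [c]. *)
pose s := Num.sqrt theta.
have s_gt1 : 1 < s by rewrite -sqrtr1 ltr_sqrt // (lt_trans ltr01).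
have s_gt0 : 0 < s by apply: lt_trans s_gt1.
apply: (@lt_le_trans _ _ (c * s)%:E); first by rewrite lte_fin ltr_pMr.
apply: le_ereal_inf_tmp => _ [_ [g /= g1 <-] <-].
have [a [a_ge0 adm a_large]] := box g g1.
apply: le_trans (mordell_constant_ge a_ge0 (admissible_symmetric_box adm)).
rewrite lee_fin -ler_sqr ?nnegrE ?mulr_ge0 ?prodr_ge0 //; last 2 first.
- exact: ltW.
- exact: ltW.
rewrite -(ler_pM2r (exprn_gt0 n n_gt0)) exprMn mulrAC c2 mul1r sqr_sqrtr //.
by apply: ltW; apply: lt_trans theta_gt1.
Qed.
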